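(* Let $K$ be a field of characteristic $0$, $R=K[x_1,\dots,x_n]$, let $I\subseteq R$ be a homogeneous ideal and let $\tau$ be a term order on $R$ with $x_1>_\tau\dots>_\tau x_n$. Then $$\beta_{ijp}(R/\mathrm{Gin}(I))\le \beta_{ijp}(R/\mathrm{Gin}_\tau(I))$$ for every $i,j,p$.
   Context: $R$ has the standard grading, and a subscript $j$ on the right of a graded module denotes its degree $j$ component. Koszul-Betti numbers: for a homogeneous ideal $J$ and $p=1,\dots,n$ let $H_i(p,R/J)$ be the $i$-th homology of the graded Koszul complex with values in $R/J$ with respect to a sequence of $p$ generic linear forms of $R$, and set $\beta_{ijp}(R/J)=\dim_K H_i(p,R/J)_j$. (''Generic'' means: the sequence belongs to a nonempty Zariski open subset of $(R_1)^p$ on which these dimensions are constant.) For $p=0$ one sets $H_0(0,R/J)=R/J$, and $H_i(p,R/J)=0$ whenever $i>p$. Thus $i\ge0$, $j\in\mathbb Z$, $0\le p\le n$. $g=(g_{ij})\in \mathrm{GL}_n(K)$ acts on $R$ as the graded $K$-algebra isomorphism $g(x_i)=\sum_{j=1}^n g_{ji}x_j$. $\mathrm{Gin}_\tau(I)$ is the initial ideal $\mathrm{in}_\tau(g(I))$ for generic $g\in\mathrm{GL}_n(K)$ (i.e. the common value for $g$ in a suitable nonempty Zariski open subset). $\mathrm{Gin}(I)$ denotes the generic initial ideal with respect to the (degree) reverse lexicographic order with $x_1>\dots>x_n$. *)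

(* Defs.v *)
From Stdlib Require Import ClassicalEpsilon.
From HB Require Import structures.
From mathcomp Require Import all_boot all_order all_algebra.
From mathcomp.multinomials Require Import mpoly.

Set Implicit Arguments.
Unset Strict Implicit.
Unset Printing Implicit Defensive.

Import Order.TTheory GRing.Theory Num.Theory.

Local Open Scope ring_scope.

Section Generic.

Variable K : fieldType.

(* The complement of the common zero locus of a family of polynomials in the
   m * n entries of the matrix. *)
Definition zariski_open (m n : nat) (U : 'M[K]_(m, n) -> Prop) : Prop :=
  exists F : {mpoly K[m * n]} -> Prop,
    forall A, U A <-> exists2 f, F f & f.@[fun k => mxvec A 0 k] != 0.

(* [t] is the common value of [F] on some nonempty open subset of [D], for the
   topology induced by the Zariski topology. *)
Definition is_generic_value (m n : nat) (T : Type) (D : 'M[K]_(m, n) -> Prop)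
    (F : 'M[K]_(m, n) -> T) (t : T) : Prop :=
  exists U : 'M[K]_(m, n) -> Prop,
    [/\ zariski_open U, exists A, D A /\ U A
      & forall A, D A -> U A -> F A = t].

(* Over an infinite field, and for [D] all of the matrices or the invertible
   ones, any two nonempty open subsets of [D] meet, so there is at most one
   generic value; [t0] is only the value when there is none. *)
Definition generic_value (m n : nat) (T : Type) (t0 : T)
    (D : 'M[K]_(m, n) -> Prop) (F : 'M[K]_(m, n) -> T) : T :=
  epsilon (inhabits t0) (is_generic_value D F).

End Generic.

Section Ideals.

Variables (n : nat) (K : fieldType).
Implicit Types (I J S : {mpoly K[n]} -> Prop) (tau : rel 'X_{1..n}).

Definition is_ideal J : Prop :=
  [/\ J 0, forall f g, J f -> J g -> J (f + g) & forall f g, J g -> J (f * g)].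

Definition is_homogeneous J : Prop :=
  forall f (d : nat), J f -> J (pihomog mdeg d f).

Definition ideal_generated S : {mpoly K[n]} -> Prop :=
  fun f => forall J, is_ideal J -> (forall g, S g -> J g) -> J f.

(* [tau a b] reads a <= b. *)
Definition is_term_order tau : Prop :=
  [/\ reflexive tau, antisymmetric tau, transitive tau & total tau]
  /\ (forall a, tau 0%MM a)
  /\ (forall a b c, tau a b -> tau (a + c)%MM (b + c)%MM).

(* x_1 > ... > x_n, for a total order. *)
Definition decreasing_variables tau : Prop :=
  forall i j : 'I_n, (i < j)%N -> ~~ tau U_(i)%MM U_(j)%MM.

(* In equal degrees a < b when the last nonzero entry of b - a is negative. *)
Definition degrevlex : rel 'X_{1..n} := fun a b =>
  (mdeg a < mdeg b)%N ||
  (mdeg a == mdeg b) &&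
    ((a == b) ||
     [exists k : 'I_n, (b k < a k)%N &&
        [forall l : 'I_n, (k < l)%N ==> (a l == b l)]]).

Definition is_initial_monomial tau (f : {mpoly K[n]}) (m : 'X_{1..n}) : Prop :=
  m \in msupp f /\ forall m', m' \in msupp f -> tau m' m.

Definition initial_ideal tau J : {mpoly K[n]} -> Prop :=
  ideal_generated
    (fun h => exists f m, [/\ J f, is_initial_monomial tau f m & h = 'X_[m]]).

(* g(x_i) = \sum_j g_{ji} x_j *)
Definition gl_act (g : 'M[K]_n) (f : {mpoly K[n]}) : {mpoly K[n]} :=
  f \mPo [tuple \sum_(j < n) g j i *: 'X_j | i < n].

Definition gl_image (g : 'M[K]_n) J : {mpoly K[n]} -> Prop :=
  fun h => exists2 f, J f & h = gl_act g f.

Definition Gin tau I : {mpoly K[n]} -> Prop :=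
  generic_value (fun _ => False) (fun g : 'M[K]_n => g \in unitmx)
    (fun g => initial_ideal tau (gl_image g I)).

End Ideals.

Section QuotientDimension.

Variables (K : fieldType) (V : lmodType K).

(* [Z / B] has a basis with [d] elements. *)
Definition has_quotient_dim (Z B : V -> Prop) (d : nat) : Prop :=
  exists v : 'I_d -> V,
    [/\ forall k, Z (v k),
        forall a : 'I_d -> K, B (\sum_k a k *: v k) -> forall k, a k = 0
      & forall z, Z z -> exists a : 'I_d -> K, B (z - \sum_k a k *: v k)].

Definition quotient_dim (Z B : V -> Prop) : nat :=
  epsilon (inhabits 0%N) (has_quotient_dim Z B).

End QuotientDimension.

Section Koszul.

Variables (n : nat) (K : fieldType) (J : {mpoly K[n]} -> Prop) (p : nat).

Definition in_degree (d : int) (f : {mpoly K[n]}) : Prop :=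
  forall m, m \in msupp f -> (mdeg m)%:Z = d.

Definition linear_form (A : 'M[K]_(p, n)) (s : 'I_p) : {mpoly K[n]} :=
  \sum_(k < n) A s k *: 'X_k.

(* A chain [c] stands for \sum_S c_S e_S, with e_S the exterior product of the
   basis elements e_s of R(-1)^p, s in S taken in increasing order. *)
Definition koszul_chain (i : nat) (j : int)
    (c : {ffun {set 'I_p} -> {mpoly K[n]}}) : Prop :=
  forall S : {set 'I_p}, if #|S| == i then in_degree (j - i%:Z) (c S) else c S = 0.

(* For t_0 < ... < t_q, the basis element e_{t_0, ..., t_q} is sent to the sum
   over k of (-1)^k l_{t_k} e_{t_0, ..., t_q without t_k}; the coefficient at
   S collects the terms with S = {t_0, ..., t_q} \ {s}. *)
Definition koszul_diff (A : 'M[K]_(p, n))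
    (c : {ffun {set 'I_p} -> {mpoly K[n]}}) :
    {ffun {set 'I_p} -> {mpoly K[n]}} :=
  [ffun S : {set 'I_p} => \sum_(s | s \notin S)
     (-1) ^+ #|[set t in S | (t < s)%N]| * linear_form A s * c (s |: S)].

(* Chains with values in R/J are represented by chains with values in R: the
   cycles and boundaries below are the preimages of those of the complex with
   values in R/J, so both contain the chains with values in J. *)
Definition koszul_cycle (A : 'M[K]_(p, n)) (i : nat) (j : int)
    (c : {ffun {set 'I_p} -> {mpoly K[n]}}) : Prop :=
  koszul_chain i j c /\ forall S, J (koszul_diff A c S).

Definition koszul_boundary (A : 'M[K]_(p, n)) (i : nat) (j : int)
    (c : {ffun {set 'I_p} -> {mpoly K[n]}}) : Prop :=
  koszul_chain i j c /\
  exists2 b, koszul_chain i.+1 j b & forall S, J (c S - koszul_diff A b S).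

Definition koszul_homology_dim (i : nat) (j : int) (A : 'M[K]_(p, n)) : nat :=
  quotient_dim (koszul_cycle A i j) (koszul_boundary A i j).

End Koszul.

(* For p = 0 the only chains are in homological degree 0, and this is the
   Hilbert function of R/J for i = 0. *)
Definition koszul_betti (n : nat) (K : fieldType) (i : nat) (j : int) (p : nat)
    (J : {mpoly K[n]} -> Prop) : nat :=
  generic_value 0%N (fun _ : 'M[K]_(p, n) => True) (koszul_homology_dim J i j).

(* Main.v *)
(* In characteristic 0 both generic initial ideals are strongly stable. For a
   strongly stable monomial ideal J, generic linear forms l_1, ..., l_p may be
   replaced by the last p variables y_1, ..., y_p: row operations and a
   substitution preserving J turn one sequence into the other. A matching on
   the chains x^m e_S of the Koszul complex then leaves, as a basis of its
   homology, the x^m e_S with x^m outside J, x^m prime to y_t for t > max S, and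
   x^m y_s in J for all s in S. Counting these by max S and summing by parts,
   the Koszul-Betti numbers in internal degree j become combinations with
   nonnegative coefficients of the values in degrees j - i and j - i + 1 of the
   Hilbert functions of the quotients of R/J by the variables y_t with t >= k,
   except that the Hilbert function of R/J itself also occurs with a negative
   coefficient. The latter is the same for both ideals, and the others are
   smallest for the reverse lexicographic order, because there taking initial
   ideals commutes with killing the last variables. *)
From Stdlib Require Import ClassicalEpsilon FunctionalExtensionality PropExtensionality.
Require Import Defs.
From mathcomp Require Import all_boot all_order all_algebra.
From mathcomp Require Import zify ring.
From mathcomp.multinomials Require Import mpoly.

Set Implicit Arguments.
Unset Strict Implicit.
Unset Printing Implicit Defensive.

Import Order.TTheory GRing.Theory Num.Theory.

Local Open Scope ring_scope.

(** * Polynomial functions on matrices and generic values *)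

(** A generic value is chosen by epsilon, so the first obstacle is to exhibit one nonempty open set
    on which the whole initial ideal of gI is constant. All comparisons rest on one count:
    homogeneous elements of gI that stay independent when only their coefficients in a suitable set
    X of monomials are kept force as many initial monomials in X. For X an upper set this is
    semicontinuity in g; for X the set of all monomials, invariance of the Hilbert function; for X
    the monomials in the first variables, the comparison with revlex. As tau need not refine the
    degree, one works degree by degree; Dickson's lemma and the Hilbert function reduce infinitely
    many open conditions to finitely many. The coefficients in the final summation by parts are
    binomial: a set S of i+1 indices with maximum t is t plus an i-subset of the smaller indices,
    and the number of these grows with t. The remaining factor counts a basis of the kernel of
    multiplication by y_t, which rank and nullity express by Hilbert functions. *)

Section PolynomialFunctions.

Variables (K : fieldType) (m n : nat).
Implicit Types (P Q : 'M[K]_(m, n) -> K).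

(** A property of functions on matrices, so that determinants of matrices of coefficients can serve
    as equations of open sets without handling the m n coordinates. *)
Definition polynomial_function P : Prop :=
  exists f : {mpoly K[m * n]}, forall A, P A = f.@[fun k => mxvec A 0 k].

Lemma polynomial_function_ext P Q :
  P =1 Q -> polynomial_function P -> polynomial_function Q.
Proof. by move=> PQ [f Pf]; exists f => A; rewrite -PQ. Qed.

Lemma polynomial_function_cst c : polynomial_function (fun=> c).
Proof. by exists c%:MP => A; rewrite mevalC. Qed.

Lemma polynomial_function_entry i j : polynomial_function (fun A => A i j).
Proof. by exists 'X_(mxvec_index i j) => A; rewrite mevalXU mxvecE. Qed.

Lemma polynomial_functionD P Q : polynomial_function P -> polynomial_function Q ->
  polynomial_function (fun A => P A + Q A).
Proof. by move=> [f Pf] [g Qg]; exists (f + g) => A; rewrite mevalD Pf Qg. Qed.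

Lemma polynomial_functionM P Q : polynomial_function P -> polynomial_function Q ->
  polynomial_function (fun A => P A * Q A).
Proof. by move=> [f Pf] [g Qg]; exists (f * g) => A; rewrite mevalM Pf Qg. Qed.

Lemma polynomial_function_sum (I : Type) (r : seq I) (C : pred I) F :
    (forall i, C i -> polynomial_function (F i)) ->
  polynomial_function (fun A => \sum_(i <- r | C i) F i A).
Proof.
move=> PF; elim: r => [|i r IHr].
  by apply: polynomial_function_ext (polynomial_function_cst 0) => A; rewrite big_nil.
have [Ci|nCi] := boolP (C i); last first.
  by apply: polynomial_function_ext IHr => A; rewrite big_cons (negPf nCi).
apply: polynomial_function_ext (polynomial_functionD (PF i Ci) IHr) => A.
by rewrite big_cons Ci.
Qed.

Lemma polynomial_function_prod (I : Type) (r : seq I) (C : pred I) F :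
    (forall i, C i -> polynomial_function (F i)) ->
  polynomial_function (fun A => \prod_(i <- r | C i) F i A).
Proof.
move=> PF; elim: r => [|i r IHr].
  by apply: polynomial_function_ext (polynomial_function_cst 1) => A; rewrite big_nil.
have [Ci|nCi] := boolP (C i); last first.
  by apply: polynomial_function_ext IHr => A; rewrite big_cons (negPf nCi).
apply: polynomial_function_ext (polynomial_functionM (PF i Ci) IHr) => A.
by rewrite big_cons Ci.
Qed.

Lemma polynomial_function_det k (M : 'M[K]_(m, n) -> 'M[K]_k) :
    (forall i j, polynomial_function (fun A => M A i j)) ->
  polynomial_function (fun A => \det (M A)).
Proof.
move=> PM; apply: polynomial_function_sum => s _.
apply: polynomial_functionM; first exact: polynomial_function_cst.
by apply: polynomial_function_prod.
Qed.

Lemma polynomial_function_line P A B : polynomial_function P ->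
  exists q : {poly K}, forall t, q.[t] = P (A + t *: B).
Proof.
case=> f Pf.
pose h k := (mxvec A 0 k)%:P + (mxvec B 0 k)%:P * 'X.
exists (mmap polyC h f) => t; rewrite Pf mevalE /mmap horner_sum.
apply: eq_bigr => u _; rewrite hornerM hornerC; congr (_ * _).
rewrite /mmap1 horner_prod; apply: eq_bigr => k _.
by rewrite horner_exp /h !hornerE linearD linearZ /= !mxE [t * _]mulrC.
Qed.

Hypothesis charK : [pchar K]%R =i pred0.

Lemma poly_nonroot (q : {poly K}) : q != 0 -> exists c, q.[c] != 0.
Proof.
move=> q0; apply: NNPP => nc.
have qr c : root q c by apply/negPn/negP => rc; apply: nc; exists c.
(* These integers are distinct in characteristic 0, and there is one more of them than the degree of
   [q] allows as roots. *)
pose rs : seq K := [seq k%:R | k <- iota 0 (size q)].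
suff urs : uniq rs.
  have ars : all (root q) rs by apply/allP => c _; apply: qr.
  by have := max_poly_roots q0 ars urs; rewrite size_map size_iota ltnn.
rewrite map_inj_uniq ?iota_uniq // => a b.
wlog le_ab : a b / (a <= b)%N => [wl|].
  by have [/wl//|/ltnW/wl ba /esym/ba/esym] := leqP a b.
move/esym/eqP; rewrite -subr_eq0 -natrB // ((pcharf0P K).1 charK).
by rewrite subn_eq0 => le_ba; apply/eqP; rewrite eqn_leq le_ab.
Qed.

(* Restrict to the line through the two points. *)
Lemma polynomial_functions_common P Q A B :
    polynomial_function P -> polynomial_function Q -> P A != 0 -> Q B != 0 ->
  exists C, P C != 0 /\ Q C != 0.
Proof.
move=> PP PQ PA QB.
have [p Pp] := polynomial_function_line A (B - A) PP.
have [q Qq] := polynomial_function_line A (B - A) PQ.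
have p0 : p != 0.
  by apply: contraNneq PA => p0; rewrite -[A]addr0 -(scale0r (B - A)) -Pp p0 horner0.
have q0 : q != 0.
  apply: contraNneq QB => q0.
  by rewrite -(subrK A B) addrC -[B - A]scale1r -Qq q0 horner0.
have [c] := poly_nonroot (mulf_neq0 p0 q0).
by rewrite hornerM mulf_eq0 negb_or Pp Qq => /andP[]; exists (A + c *: (B - A)).
Qed.

Variables (T : Type) (t0 : T) (D : 'M[K]_(m, n) -> Prop) (F : 'M[K]_(m, n) -> T).

(** Of the family defining the open set, one member that does not vanish at the given point
    suffices; later arguments only meet principal open sets. *)
Lemma is_generic_valueE t :
  is_generic_value D F t <->
  exists P A, [/\ polynomial_function P, D A, P A != 0
                & forall A', D A' -> P A' != 0 -> F A' = t].
Proof.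
split=> [[U [[S US] [A [DA UA]] Ft]]|[P [A [[f Pf] DA PA Ft]]]].
  have [f Sf fA] := (US A).1 UA.
  exists (fun B => f.@[fun k => mxvec B 0 k]), A; split=> //; first by exists f.
  by move=> B DB fB; apply: Ft => //; apply/US; exists f.
exists (fun B => P B != 0); split.
- exists (fun g => g = f) => B; rewrite Pf; split; first by exists f.
  by case=> g ->.
- by exists A.
- by move=> B DB PB; apply: Ft.
Qed.

Lemma generic_valueP t :
  is_generic_value D F t -> is_generic_value D F (generic_value t0 D F).
Proof. by move=> gt; apply: epsilon_spec; exists t. Qed.

(** Two generic values agree at a common point of [D] and of both open sets. That [D] is itself
    principal gives this point: [dlt] is the determinant for invertible matrices, and 1 for all
    matrices. *)
Lemma generic_valueE dlt t :
    polynomial_function dlt -> (forall A, D A <-> dlt A != 0) ->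
  is_generic_value D F t -> generic_value t0 D F = t.
Proof.
move=> Pd Dd gt; have := generic_valueP gt.
case/is_generic_valueE=> P [A [PP DA PA PF]].
case/is_generic_valueE: gt => Q [B [PQ DB QB QF]].
have dPA : dlt A * P A != 0 by rewrite mulf_neq0 //; apply/Dd.
have [C []] := polynomial_functions_common (polynomial_functionM Pd PP) PQ dPA QB.
rewrite mulf_eq0 negb_or => /andP[/Dd DC PC] QC.
by rewrite -(PF C) // (QF C).
Qed.

End PolynomialFunctions.

(** * Initial monomials *)

(** Classical truth as a boolean, so that initial monomials form a predicate whose members can be
    counted. *)
Definition asbool (P : Prop) : bool :=
  if excluded_middle_informative P then true else false.

Lemma asboolP P : reflect P (asbool P).
Proof. by rewrite /asbool; case: excluded_middle_informative => h; constructor. Qed.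

Lemma pred_ext (T : Type) (P Q : T -> Prop) : (forall x, P x <-> Q x) -> P = Q.
Proof.
by move=> PQ; apply: functional_extensionality => x; apply: propositional_extensionality.
Qed.

Lemma mcoeff_pihomog n (K : fieldType) d (f : {mpoly K[n]}) m :
  (pihomog mdeg d f)@_m = if mdeg m == d then f@_m else 0.
Proof.
rewrite pihomogE raddf_sum /=.
rewrite (eq_bigr (fun u => f@_u * (u == m)%:R)); last first.
  by move=> u _; rewrite mcoeffZ mcoeffX.
have [mf|nmf] := boolP (m \in msupp f); last first.
  rewrite (memN_msupp_eq0 nmf) if_same big_seq_cond big1 // => u /andP[uf _].
  by case: eqP => [um|_]; rewrite ?mulr0 //; rewrite um (negPf nmf) in uf.
rewrite big_mkcond (bigD1_seq m) ?msupp_uniq //= eqxx mulr1 big1 ?addr0 // => u um.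
by case: ifP => // _; rewrite (negPf um) mulr0.
Qed.

Section InitialMonomials.

Variables (n : nat) (K : fieldType) (tau : rel 'X_{1..n}).
Implicit Types (V : {mpoly K[n]} -> Prop) (f g : {mpoly K[n]}) (m u : 'X_{1..n}).

Definition initial_monomials V : pred 'X_{1..n} :=
  fun m => asbool (exists2 f, V f & is_initial_monomial tau f m).

Lemma ideal0 V : is_ideal V -> V 0. Proof. by case. Qed.
Lemma idealD V f g : is_ideal V -> V f -> V g -> V (f + g). Proof. by move=> [_ h _]; apply: h. Qed.
Lemma idealM V f g : is_ideal V -> V g -> V (f * g). Proof. by move=> [_ _ h]; apply: h. Qed.
Lemma idealZ V c f : is_ideal V -> V f -> V (c *: f).
Proof. by move=> iV Vf; rewrite -mul_mpolyC; apply: idealM. Qed.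

Lemma ideal_sum V (T : Type) (r : seq T) (C : pred T) (F : T -> {mpoly K[n]}) :
  is_ideal V -> (forall i, C i -> V (F i)) -> V (\sum_(i <- r | C i) F i).
Proof. by move=> [V0 VD _] VF; elim/big_ind: _. Qed.

Hypothesis htau : is_term_order tau.

Let tau_refl u : tau u u. Proof. by have [[]] := htau. Qed.
Let tau_trans a b c : tau a b -> tau b c -> tau a c.
Proof. by have [[_ _ h _] _] := htau; apply: h. Qed.
Let tau_total a b : tau a b || tau b a.
Proof. by have [[_ _ _ h] _] := htau; apply: h. Qed.

Lemma greatest_monomial (s : seq 'X_{1..n}) m0 : m0 \in s ->
  exists2 m, m \in s & forall u, u \in s -> tau u m.
Proof.
elim: s m0 => // a [|b s] IHs m0 _.
  by exists a; rewrite ?inE // => u; rewrite inE => /eqP->.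
have [m ms mmax] := IHs b (mem_head _ _).
case/orP: (tau_total a m) => am.
  exists m; first by rewrite inE ms orbT.
  by move=> u; rewrite in_cons => /predU1P[->//|]; apply: mmax.
exists a; first exact: mem_head.
move=> u; rewrite in_cons => /predU1P[->//|/mmax um].
exact: tau_trans um am.
Qed.

Lemma initial_monomial_exists f u :
  u \in msupp f -> exists2 m, is_initial_monomial tau f m & tau u m.
Proof. by move=> uf; have [m mf mmax] := greatest_monomial uf; exists m; last exact: mmax. Qed.

Lemma initial_monomials_up V m u :
  is_ideal V -> initial_monomials V m -> initial_monomials V (u + m)%MM.
Proof.
move=> iV /asboolP[f Vf [mf fm]]; apply/asboolP.
exists ('X_[u] * f); first exact: idealM.
rewrite mulrC; split=> [|m']; rewrite (perm_mem (msuppMX _ _)).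
  by apply/mapP; exists m; rewrite // addmC.
case/mapP=> v /fm vm ->; rewrite addmC [(u + m)%MM]addmC.
by have [_ [_ h]] := htau; apply: h.
Qed.

(** Initial monomials are stable under multiplication by monomials, so their span is already an
    ideal and membership is read off the support. *)
Lemma initial_idealE V f : is_ideal V ->
  initial_ideal tau V f <-> {in msupp f, forall m, initial_monomials V m}.
Proof.
move=> iV; split=> If; last first.
  move=> J [J0 JD JM] JS; rewrite [f]mpolyE big_seq; elim/big_ind: _ => // m /If.
  move=> /asboolP[g Vg gm]; rewrite -mul_mpolyC; apply/JM/JS.
  by exists g, m.
pose W g := {in msupp g, forall m, initial_monomials V m}.
apply: (If W); rewrite /W; first split.
- by move=> m; rewrite msupp0.
- move=> g h Ig Ih m /msuppD_le; rewrite mem_cat.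
  by case/orP=> [/Ig|/Ih].
- move=> g h Ih m /msuppM_le /allpairsP[[a b] /= [_ /Ih bV ->]].
  exact: initial_monomials_up.
move=> _ [g [m [Vg gm ->]]] m'; rewrite msuppX inE => /eqP->.
by apply/asboolP; exists g.
Qed.

(* A family of more than #|S| elements has a nontrivial linear combination
   without the monomials of S; for S the initial monomials of V in X, this
   contradicts the independence of the family. *)
Lemma card_initial_ge V d (X : pred 'X_{1..n}) (T : finType) (F : T -> {mpoly K[n]}) :
    is_ideal V -> (forall r, V (F r)) -> (forall r, F r \is d.-homog) ->
    (forall f m u, f \is d.-homog -> u \in msupp f -> X u ->
       is_initial_monomial tau f m -> X m) ->
    (forall v : T -> K, (exists r, v r != 0) ->
       exists2 u, X u & (\sum_r v r *: F r)@_u != 0) ->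
  (#|T| <= #|[pred m : 'X_{1..n < d.+1} |
              [&& mdeg m == d, X m & initial_monomials V m]]|)%N.
Proof.
move=> iV VF dF Xin indep; set S := [pred m | _]; rewrite leqNgt; apply/negP => ltST.
pose M := \matrix_(r < #|T|, c < #|S|)
  (F (enum_val r))@_(val (enum_val c : 'X_{1..n < d.+1})).
have : kermx M != 0.
  rewrite kermx_eq0 /row_free neq_ltn; apply/orP; left.
  exact: leq_ltn_trans (rank_leq_col M) ltST.
case/rowV0Pn=> v /sub_kermxP vM /eqP/rowP nv0.
pose w (r : T) := v 0 (enum_rank r).
have wnz : exists r, w r != 0.
  apply: NNPP => h; apply: nv0 => r; rewrite mxE.
  by apply/eqP/negPn/negP => vr; apply: h; exists (enum_val r); rewrite /w enum_valK.
have [u Xu fu] := indep w wnz; set f := \sum_r _ in fu.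
have df : f \is d.-homog by apply: rpred_sum => r _; apply: rpredZ.
have Vf : V f by apply: ideal_sum => // r _; apply: idealZ.
rewrite -mcoeff_msupp in fu.
have [m mf _] := initial_monomial_exists fu.
have [msf _] := mf.
have dm : mdeg m = d by apply: (dhomogP _ _ _ df).
have md : (mdeg m < d.+1)%N by rewrite dm.
pose b := BMultinom md.
have bS : b \in S.
  rewrite inE /= dm eqxx (Xin f m u) //=.
  by apply/asboolP; exists f.
move: msf; rewrite mcoeff_msupp => /eqP; apply.
have /rowP/(_ (enum_rank_in bS b)) := vM; rewrite !mxE => <-.
rewrite raddf_sum /= (reindex (fun r : 'I_#|T| => enum_val r)) /=; last first.
  by apply: onW_bij; exists enum_rank; [apply: enum_valK|apply: enum_rankK].
by apply: eq_bigr => r _; rewrite mcoeffZ /w enum_valK mxE enum_rankK_in.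
Qed.

(** Take for [s] the index with the greatest [k s] among those with a nonzero [v s]: only the
    diagonal term survives in the sum. *)
Lemma triangular_independent (T : finType) (k : T -> 'X_{1..n}) (c : T -> 'X_{1..n} -> K) :
    injective k -> (forall r, c r (k r) != 0) ->
    (forall r s, r != s -> tau (k r) (k s) -> c r (k s) = 0) ->
  forall v : T -> K, (exists r, v r != 0) -> exists s, \sum_r v r * c r (k s) != 0.
Proof.
move=> kI cd c0 v [r0 vr0].
have : k r0 \in [seq k r | r <- enum T & v r != 0].
  by apply: map_f; rewrite mem_filter vr0 mem_enum.
case/greatest_monomial => _ /mapP[s + ->] smax.
rewrite mem_filter => /andP[vs _]; exists s.
rewrite (bigD1 s) //= big1 ?addr0 ?mulf_neq0 // => r rs.
have [->|vr] := eqVneq (v r) 0; first by rewrite mul0r.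
by rewrite c0 ?mulr0 //; apply: smax; apply: map_f; rewrite mem_filter vr mem_enum.
Qed.

(** The component of degree [mdeg m] keeps [m] and loses only other monomials, so it has the same
    initial monomial even when [tau] ignores degrees. *)
Lemma initial_monomials_homog V m : is_homogeneous V -> initial_monomials V m ->
  exists f, [/\ V f, is_initial_monomial tau f m & f \is (mdeg m).-homog].
Proof.
move=> hV /asboolP[f Vf [mf fm]]; exists (pihomog mdeg (mdeg m) f); split.
- exact: hV.
- split=> [|u]; first by rewrite mcoeff_msupp mcoeff_pihomog eqxx -mcoeff_msupp.
  by rewrite mcoeff_msupp mcoeff_pihomog; case: ifP => _; rewrite ?eqxx // -mcoeff_msupp => /fm.
- exact: pihomogP.
Qed.

End InitialMonomials.

(** * Linear substitutions and their action on ideals *)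

Section LinearSubstitutions.

Variables (n : nat) (K : fieldType).
Implicit Types (f h : {mpoly K[n]}) (g : 'M[K]_n).

Lemma gl_actD g : {morph gl_act g : f h / f + h}.
Proof. by move=> f h; rewrite /gl_act comp_mpolyD. Qed.

Lemma gl_act0 g : gl_act g 0 = 0.
Proof. by rewrite /gl_act comp_mpoly0. Qed.

Lemma gl_actZ g c f : gl_act g (c *: f) = c *: gl_act g f.
Proof. by rewrite /gl_act comp_mpolyZ. Qed.

Lemma gl_actM g : {morph gl_act g : f h / f * h}.
Proof. by move=> f h; rewrite /gl_act rmorphM. Qed.

Lemma gl_act_sum g (T : Type) (r : seq T) (C : pred T) (F : T -> {mpoly K[n]}) :
  gl_act g (\sum_(i <- r | C i) F i) = \sum_(i <- r | C i) gl_act g (F i).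
Proof. by rewrite /gl_act raddf_sum. Qed.

Lemma gl_act_prod g (T : Type) (r : seq T) (F : T -> {mpoly K[n]}) :
  gl_act g (\prod_(i <- r) F i) = \prod_(i <- r) gl_act g (F i).
Proof.
elim: r => [|i r IHr]; first by rewrite !big_nil /gl_act comp_mpoly1.
by rewrite !big_cons gl_actM IHr.
Qed.

Lemma gl_act_exp g k : {morph gl_act g : f / f ^+ k}.
Proof.
move=> f; elim: k => [|k IHk]; first by rewrite !expr0 /gl_act comp_mpoly1.
by rewrite !exprS gl_actM IHk.
Qed.

Lemma gl_actXU g i : gl_act g 'X_i = \sum_(j < n) g j i *: 'X_j.
Proof. by rewrite /gl_act comp_mpolyXU -tnth_nth tnth_mktuple. Qed.

Lemma gl_actX g m : gl_act g 'X_[m] = \prod_(i < n) (\sum_(j < n) g j i *: 'X_j) ^+ m i.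
Proof. by rewrite /gl_act comp_mpolyX; apply: eq_bigr => i _; rewrite tnth_mktuple. Qed.

Lemma gl_act_comp g (h : 'M[K]_n) f : gl_act h (gl_act g f) = gl_act (h *m g) f.
Proof.
elim/mpolyind: f => [|c m f _ _ IHf]; first by rewrite !gl_act0.
rewrite !gl_actD !gl_actZ IHf.
suff -> : gl_act h (gl_act g 'X_[m]) = gl_act (h *m g) 'X_[m] by [].
rewrite !gl_actX gl_act_prod; apply: eq_bigr => i _.
rewrite gl_act_exp gl_act_sum; congr (_ ^+ _).
rewrite (eq_bigr (fun j => \sum_(k < n) g j i *: (h k j *: 'X_k))); last first.
  by move=> j _; rewrite gl_actZ gl_actXU scaler_sumr.
rewrite exchange_big /=; apply: eq_bigr => k _.
rewrite mxE scaler_suml; apply: eq_bigr => j _.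
by rewrite scalerA mulrC.
Qed.

Lemma gl_act1 f : gl_act 1%:M f = f.
Proof.
rewrite -[RHS](comp_mpoly_id f) /gl_act; congr (_ \mPo _).
apply: eq_from_tnth => i; rewrite !tnth_mktuple (bigD1 i) //= mxE eqxx scale1r.
by rewrite big1 ?addr0 // => j ji; rewrite mxE (negPf ji) scale0r.
Qed.

Lemma gl_act_homogX g m : gl_act g 'X_[m] \is (mdeg m).-homog.
Proof.
rewrite gl_actX mdegE; elim/big_rec2: _ => [|i d f _ fd]; first exact: dhomog1.
apply: dhomogM => //.
have l1 : \sum_(j < n) g j i *: 'X_j \is [in K[n], 1.-homog].
  by apply: rpred_sum => j _; apply: rpredZ; rewrite dhomogX; apply/eqP/mdeg1.
by rewrite -[X in X.-homog]mul1n; apply: dhomogMn l1.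
Qed.

Lemma pihomog_gl_act g d f :
  pihomog mdeg d (gl_act g f) = gl_act g (pihomog mdeg d f).
Proof.
elim/mpolyind: f => [|c m f _ _ IHf]; first by rewrite !(gl_act0, pihomog0).
rewrite !(gl_actD, pihomogD) IHf !linearZ /= !gl_actZ linearZ /=.
suff -> : pihomog mdeg d (gl_act g 'X_[m]) = gl_act g (pihomog mdeg d 'X_[m]) by [].
rewrite pihomogX; case: eqP => [<-|/eqP md].
  exact/pihomog_dE/gl_act_homogX.
by rewrite gl_act0 (pihomog_ne0 md) // gl_act_homogX.
Qed.

Lemma gl_act_homog g d f : f \is d.-homog -> gl_act g f \is d.-homog.
Proof. by move=> fd; rewrite -(pihomog_dE fd) -pihomog_gl_act pihomogP. Qed.

Section Image.

Variables (I : {mpoly K[n]} -> Prop) (g : 'M[K]_n).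

Lemma gl_image_ideal : is_ideal I -> g \in unitmx -> is_ideal (gl_image g I).
Proof.
move=> [I0 ID IM] gu; split.
- by exists 0; rewrite ?gl_act0.
- by move=> _ _ [f If ->] [h Ih ->]; exists (f + h); rewrite ?gl_actD //; apply: ID.
- move=> f _ [h Ih ->]; exists (gl_act (invmx g) f * h); first exact: IM.
  by rewrite gl_actM gl_act_comp mulmxV // gl_act1.
Qed.

Lemma gl_image_homogeneous : is_homogeneous I -> is_homogeneous (gl_image g I).
Proof.
move=> hI _ d [f If ->]; exists (pihomog mdeg d f); first exact: hI.
by rewrite pihomog_gl_act.
Qed.

Lemma gl_image_comp (h : 'M[K]_n) f : gl_image g I f -> gl_image (h *m g) I (gl_act h f).
Proof. by case=> f' If' ->; exists f'; rewrite ?gl_act_comp. Qed.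

End Image.

(** Having coefficients polynomial in the entries of g is stable under sums, products and powers,
    and holds for the images of the variables. *)
Lemma polynomial_function_gl_act f m : polynomial_function (fun g => (gl_act g f)@_m).
Proof.
pose P (F : 'M[K]_n -> {mpoly K[n]}) := forall u, polynomial_function (fun g => (F g)@_u).
have PC h : P (fun=> h) by move=> u; apply: polynomial_function_cst.
have PM F G : P F -> P G -> P (fun g => F g * G g).
  move=> PF PG u; apply: polynomial_function_ext (fun g => esym (mcoeffM _ _ _)) _.
  by apply: polynomial_function_sum => k _; apply: polynomial_functionM.
have PS (T : Type) (r : seq T) (F : T -> 'M[K]_n -> {mpoly K[n]}) :
    (forall i, P (F i)) -> P (fun g => \sum_(i <- r) F i g).
  move=> PF u; apply: polynomial_function_ext (fun g => esym (raddf_sum _ _ _ _)) _.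
  by apply: polynomial_function_sum => i _; apply: PF.
have PX F k : P F -> P (fun g => F g ^+ k).
  move=> PF; elim: k => [|k IHk u]; first exact: PC.
  by apply: polynomial_function_ext (PM _ _ PF IHk u) => g; rewrite exprS.
have PZ (c : 'M[K]_n -> K) h : polynomial_function c -> P (fun g => c g *: h).
  move=> Pc u; apply: polynomial_function_ext (fun g => esym (mcoeffZ _ _ _)) _.
  by apply: polynomial_functionM => //; apply: polynomial_function_cst.
move: m; change (P (fun g => gl_act g f)).
elim/mpolyind: f => [|c m f _ _ IHf] u.
  by apply: polynomial_function_ext (PC 0 u) => g; rewrite gl_act0.
pose F i g := (\sum_(j < n) g j i *: 'X_j) ^+ m i : {mpoly K[n]}.
have PF : P (fun g => \prod_(i < n) F i g).
  move=> v; have Q (r : seq 'I_n) : P (fun g => \prod_(i <- r) F i g).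
    elim: r => [|i r IHr] w.
      by apply: polynomial_function_ext (PC 1 w) => g; rewrite big_nil.
    have PFi : P (F i) by apply: PX; apply: PS => j; apply/PZ/polynomial_function_entry.
    by apply: polynomial_function_ext (PM _ _ PFi IHr w) => g; rewrite big_cons.
  exact: Q.
apply: (polynomial_function_ext (P := fun g =>
    c * (\prod_(i < n) F i g)@_u + (gl_act g f)@_u)) => [g|].
  by rewrite gl_actD gl_actZ mcoeffD mcoeffZ gl_actX.
apply: polynomial_functionD; last exact: IHf.
by apply: polynomial_functionM; [apply: polynomial_function_cst | apply: PF].
Qed.

End LinearSubstitutions.

(** * Dickson's lemma *)

Lemma nondecreasing_subsequence (a : nat -> nat) : exists phi : nat -> nat,
  {homo phi : i j / (i < j)%N} /\ {homo a \o phi : i j / (i <= j)%N}.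
Proof.
(* A position where the minimum of the tail from [N] on is attained; jumping from one such position
   to the next gives the subsequence. *)
have tail N : exists k, (N <= k)%N /\ forall j, (N <= j)%N -> (a k <= a j)%N.
  suff h v : forall k, (N <= k)%N -> (a k <= v)%N ->
      exists k', (N <= k')%N /\ forall j, (N <= j)%N -> (a k' <= a j)%N.
    exact: (h (a N) N).
  elim: v => [|v IHv] k Nk akv.
    by exists k; split=> // j _; apply: leq_trans akv _.
  have [[j [Nj ajv]]|nj] := classic (exists j, (N <= j)%N /\ (a j <= v)%N).
    exact: IHv Nj ajv.
  exists k; split=> // j Nj; apply: leq_trans akv _; rewrite ltnNge.
  by apply/negP => ajv; apply: nj; exists j.
pose s N := proj1_sig (constructive_indefinite_description _ (tail N)).
have sN N : (N <= s N)%N by rewrite /s; case: constructive_indefinite_description => k [].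
have sa N j : (N <= j)%N -> (a (s N) <= a j)%N.
  by rewrite /s; case: constructive_indefinite_description => k [] //= _; apply.
pose phi := fix phi k := if k is k'.+1 then s (phi k').+1 else s 0%N.
have phiS k : (phi k < phi k.+1)%N by apply: sN.
have lt_phi : {homo phi : i j / (i < j)%N} by apply: homo_ltn => //; apply: ltn_trans.
exists phi; split=> //; apply: homo_leq => //; first exact: leq_trans.
case=> [|i] /=; apply: sa => //.
exact: ltn_trans (phiS i) (phiS i.+1).
Qed.

Lemma nondecreasing_subsequence_vector n (f : nat -> 'I_n -> nat) :
  exists phi : nat -> nat, {homo phi : i j / (i < j)%N} /\
    forall k, {homo (fun i => f (phi i) k) : i j / (i <= j)%N}.
Proof.
suff h (s : seq 'I_n) : exists phi : nat -> nat, {homo phi : i j / (i < j)%N} /\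
    forall k, k \in s -> {homo (fun i => f (phi i) k) : i j / (i <= j)%N}.
  by have [phi [p1 p2]] := h (enum 'I_n); exists phi; split=> // k; apply: p2; rewrite mem_enum.
elim: s => [|k s [phi [p1 p2]]]; first by exists id; split=> [|k]; rewrite ?in_nil.
have [psi [q1 q2]] := nondecreasing_subsequence (fun i => f (phi i) k).
exists (phi \o psi); split=> [i j ij|]; first exact/p1/q1.
move=> l; rewrite inE => /predU1P[-> i j /q2//|ls i j ij]; apply: p2 => //.
exact: ltnW_homo q1 _ _ ij.
Qed.

(** Finite generation is expressed as a bound on the degrees of generators, which is the form used
    to reduce genericity to finitely many degrees. *)
Lemma dickson n (G : 'X_{1..n} -> Prop) :
  exists D, forall m, G m -> exists m', [/\ G m', (mdeg m' <= D)%N & (m' <= m)%MM].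
Proof.
apply: NNPP => nD.
have bad D : exists m, G m /\ forall m', G m' -> (mdeg m' <= D)%N -> ~~ (m' <= m)%MM.
  apply: NNPP => nm; apply: nD; exists D => m Gm; apply: NNPP => nm'.
  apply: nm; exists m; split=> // m' Gm' dm'; apply/negP => lem'.
  by apply: nm'; exists m'.
pose f D := proj1_sig (constructive_indefinite_description _ (bad D)).
have fG D : G (f D) by rewrite /f; case: constructive_indefinite_description => m [].
have fbad D m' : G m' -> (mdeg m' <= D)%N -> ~~ (m' <= f D)%MM.
  by rewrite /f; case: constructive_indefinite_description => m [] //= _; apply.
have [phi [p1 p2]] := nondecreasing_subsequence_vector (fun D k => f D k).
(* [f (phi j)] was chosen to be divisible by no element of [G] of degree at most [phi j], but
   [f (phi 0)] has degree j <= phi j and divides it. *)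
pose j := mdeg (f (phi 0%N)).
have jphi : (j <= phi j)%N.
  by elim: j => // j IHj; apply: leq_ltn_trans IHj (p1 _ _ _).
have /negP[] := fbad _ _ (fG (phi 0%N)) jphi.
by apply/mnm_lepP => k; apply: p2.
Qed.

(** * Generic initial ideals *)

Lemma bounded_max (T : Type) (D : T -> Prop) (w : T -> nat) B t0 :
    D t0 -> (forall t, D t -> (w t <= B)%N) ->
  exists2 t1, D t1 & forall t, D t -> (w t <= w t1)%N.
Proof.
move=> Dt0 wB; suff h k : forall t, D t -> (B <= w t + k)%N ->
    exists2 t1, D t1 & forall t, D t -> (w t <= w t1)%N.
  by apply: (h B t0) => //; apply: leq_addl.
elim: k => [|k IHk] t Dt Bt.
  by exists t => // t' Dt'; rewrite addn0 in Bt; apply: leq_trans (wB _ Dt') Bt.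
have [[t' [Dt' lt_tt']]|nt'] := classic (exists t', D t' /\ (w t < w t')%N).
  by apply: (IHk t') => //; lia.
exists t => // t' Dt'; rewrite leqNgt; apply/negP => lt_tt'; apply: nt'.
by exists t'.
Qed.

Lemma det_independent (K : fieldType) k (M : 'M[K]_k) :
  \det M != 0 <->
  forall v : 'I_k -> K, (exists r, v r != 0) -> exists s, \sum_r v r * M r s != 0.
Proof.
split=> [dM v [r vr]|ind].
  apply: NNPP => ns; move/det0P: dM; apply.
  exists (\row_r v r).
    by apply: contraNneq vr => /rowP/(_ r); rewrite !mxE => ->.
  apply/rowP => s; rewrite !mxE; apply/eqP/negPn/negP => sM; apply: ns.
  by exists s; rewrite (eq_bigr (fun r' => (\row_i v i) 0 r' * M r' s)) // => r' _; rewrite mxE.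
apply/det0P => -[v v0 vM].
have [|s] := ind (fun r => v 0 r).
  apply: NNPP => nr; move/eqP: v0; apply; apply/rowP => r; rewrite mxE.
  by apply/eqP/negPn/negP => vr; apply: nr; exists r.
by move/rowP/(_ s): vM; rewrite !mxE => ->; rewrite eqxx.
Qed.

Definition degree_part n d (X E : pred 'X_{1..n}) : {pred 'X_{1..n < d.+1}} :=
  [pred m | [&& mdeg (val m) == d, X (val m) & E (val m)]].
Arguments degree_part {n} d X E.

Section GenericInitialIdeal.

Variables (n : nat) (K : fieldType) (I : {mpoly K[n]} -> Prop).
Hypothesis charK : [pchar K]%R =i pred0.
Hypothesis hI : is_ideal I.
Hypothesis hIh : is_homogeneous I.

Implicit Types (g : 'M[K]_n) (P : 'M[K]_n -> K) (m u : 'X_{1..n}).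

Lemma polynomial_function_det1 : polynomial_function (fun g => \det g).
Proof. by apply: polynomial_function_det => i j; apply: polynomial_function_entry. Qed.

Lemma unitmx_det g : g \in unitmx <-> \det g != 0.
Proof. by rewrite unitmxE unitfE. Qed.

Lemma generic_common P Q g h :
    polynomial_function P -> polynomial_function Q -> g \in unitmx ->
    P g != 0 -> Q h != 0 -> exists C, [/\ C \in unitmx, P C != 0 & Q C != 0].
Proof.
move=> PP PQ /unitmx_det dg Pg Qh.
have [] := polynomial_functions_common charK
  (polynomial_functionM polynomial_function_det1 PP) PQ (mulf_neq0 dg Pg) Qh.
by move=> C []; rewrite mulf_eq0 negb_or => /andP[dC PC] QC; exists C; split=> //; apply/unitmx_det.
Qed.

(** The family is taken in I rather than in gI, so that the same elements can afterwards be moved by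
    other matrices. *)
Lemma initial_basis tau g d (S : {pred 'X_{1..n < d.+1}}) :
    {in S, forall m : 'X_{1..n < d.+1},
      mdeg m = d /\ initial_monomials tau (gl_image g I) m} ->
    g \in unitmx ->
  exists h : 'I_#|S| -> {mpoly K[n]}, forall r,
    [/\ I (h r), h r \is d.-homog
      & is_initial_monomial tau (gl_act g (h r)) (val (enum_val r : 'X_{1..n < d.+1}))].
Proof.
move=> hS gu.
suff h (r : 'I_#|S|) : exists f, [/\ I f, f \is d.-homog
    & is_initial_monomial tau (gl_act g f) (val (enum_val r : 'X_{1..n < d.+1}))].
  by have [f hf] := fin_all_exists h; exists f.
set m := val _.
have [dm Em] := hS _ (enum_valP r).
have [_ [[f If ->] fm fd]] := initial_monomials_homog (gl_image_homogeneous hIh) Em.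
exists f; split=> //; rewrite -[f]gl_act1 -(mulVmx gu) -gl_act_comp.
by apply: gl_act_homog; rewrite -dm.
Qed.

Section Order.

Variable tau : rel 'X_{1..n}.
Hypothesis htau : is_term_order tau.

Let E g := initial_monomials tau (gl_image g I).

Lemma initial_independent T (F : 'I_T -> {mpoly K[n]}) (k : 'I_T -> 'X_{1..n}) :
    injective k -> (forall r, is_initial_monomial tau (F r) (k r)) ->
  forall v : 'I_T -> K, (exists r, v r != 0) ->
    exists s, (\sum_r v r *: F r)@_(k s) != 0.
Proof.
move=> kI Fk v vn.
have [||s] := triangular_independent htau (c := fun r u => (F r)@_u) kI _ _ vn.
- by move=> r; rewrite -mcoeff_msupp; case: (Fk r).
- move=> r s rs krs; apply/memN_msupp_eq0/negP => ks.
  have [_ /(_ _ ks) ksr] := Fk r.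
  have [[_ anti _ _] _] := htau.
  by move/eqP: rs; apply; apply: kI; apply: anti; rewrite krs.
exists s; rewrite raddf_sum /=.
by under eq_bigr => r _ do rewrite mcoeffZ.
Qed.

Lemma degree_part_inj d (S : {pred 'X_{1..n < d.+1}}) :
  injective (fun r : 'I_#|S| => val (enum_val r : 'X_{1..n < d.+1})).
Proof. by move=> r s /val_inj/enum_val_inj. Qed.

Lemma upper_initial d (X : pred 'X_{1..n}) :
    (forall u v, X u -> tau u v -> X v) ->
  forall (f : {mpoly K[n]}) m u, f \is d.-homog -> u \in msupp f -> X u ->
    is_initial_monomial tau f m -> X m.
Proof. by move=> Xup f m u _ uf Xu [_ /(_ _ uf)]; apply: Xup. Qed.

(** Semicontinuity. [P] is the determinant of the coefficients, at the initial monomials found for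
    [g0], of the images of elements of I. It is triangular at [g0]; where it does not vanish, the
    images remain independent on X. *)
Lemma initial_dominance d (X : pred 'X_{1..n}) g0 :
    (forall u v, X u -> tau u v -> X v) -> g0 \in unitmx ->
  exists P, [/\ polynomial_function P, P g0 != 0
    & forall g, g \in unitmx -> P g != 0 ->
        (#|degree_part d X (E g0)| <= #|degree_part d X (E g)|)%N].
Proof.
move=> Xup g0u; set S := degree_part d X (E g0).
have hS (m : 'X_{1..n < d.+1}) : m \in S -> [/\ mdeg (val m) = d, X (val m) & E g0 (val m)].
  by case/and3P=> /eqP.
have [m mS|h hh] := initial_basis (S := S) (g := g0) (tau := tau) _ g0u.
  by have [dm _ Em] := hS m mS.
pose k (r : 'I_#|S|) := val (enum_val r : 'X_{1..n < d.+1}).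
pose M g := \matrix_(r, s) (gl_act g (h r))@_(k s).
have coefM g (v : 'I_#|S| -> K) s :
    (\sum_r v r *: gl_act g (h r))@_(k s) = \sum_r v r * M g r s.
  by rewrite raddf_sum; apply: eq_bigr => r _; rewrite /= mcoeffZ mxE.
exists (fun g => \det (M g)); split.
- apply: polynomial_function_det => r s.
  apply: polynomial_function_ext (polynomial_function_gl_act (h r) (k s)) => g.
  by rewrite mxE.
- apply/det_independent => v vn.
  have Fk r : is_initial_monomial tau (gl_act g0 (h r)) (k r) by have [] := hh r.
  have [s] := initial_independent (@degree_part_inj _ S) Fk vn.
  by exists s; rewrite -coefM.
move=> g gu /det_independent indep; rewrite -[X in (X <= _)%N]card_ord.
have := card_initial_ge htau (V := gl_image g I) (X := X) (F := fun r => gl_act g (h r)).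
apply; first exact: gl_image_ideal.
- by move=> r; exists (h r) => //; case: (hh r).
- by move=> r; apply: gl_act_homog; case: (hh r).
- exact: upper_initial.
move=> v /indep[s]; rewrite -coefM; exists (k s) => //.
by have [] := hS _ (enum_valP s).
Qed.

Lemma degree_part_pred d (F : pred 'X_{1..n}) (m : 'X_{1..n < d.+1}) :
    mdeg (val m) = d ->
  #|degree_part d (tau (val m)) F| =
    (F (val m) + #|degree_part d (fun u => tau (val m) u && (u != val m)) F|)%N.
Proof.
move=> dm; rewrite (cardD1 m) inE dm eqxx; have [[-> _ _ _] _] := htau; congr (_ + _)%N.
apply: eq_card => u; rewrite !inE -val_eqE -andbA [LHS]andbCA; congr (_ && _).
by rewrite [LHS]andbCA.
Qed.

(** Choose [g0] maximizing the sum of all counts on upper sets. By semicontinuity each count is at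
    least as large for generic g, hence equal by maximality, and the counts above a monomial, with
    and without it, tell whether it is initial. *)
Lemma generic_degree d : exists P g0, [/\ polynomial_function P, g0 \in unitmx, P g0 != 0
  & forall g, g \in unitmx -> P g != 0 -> forall m, mdeg m = d -> E g m = E g0 m].
Proof.
pose X (kb : 'X_{1..n < d.+1} * bool) : pred 'X_{1..n} :=
  if kb.2 then tau (val kb.1) else fun u => tau (val kb.1) u && (u != val kb.1).
pose N g kb := #|degree_part d (X kb) (E g)|.
have Xup kb u v : X kb u -> tau u v -> X kb v.
  have [[_ anti tr _] _] := htau.
  rewrite /X; case: kb => k [] /= => [|/andP[ku uk]] uv; first exact: tr uv.
  rewrite (tr _ _ _ ku uv); apply: contraNneq uk => vk.
  by apply/eqP/anti; rewrite ku andbT -vk.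
have [||g0 g0u g0max] := @bounded_max _ (fun g => g \in unitmx)
    (fun g => \sum_kb N g kb)%N
    (\sum_(kb : 'X_{1..n < d.+1} * bool) #|{: 'X_{1..n < d.+1}}|)%N 1%:M.
- exact: unitmx1.
- by move=> g _; apply: leq_sum => kb _; apply: max_card.
have /fin_all_exists[P hP] kb := initial_dominance d (Xup kb) g0u.
exists (fun g => \prod_kb P kb g), g0; split; [|exact: g0u| |].
- by apply: polynomial_function_prod => kb _; case: (hP kb).
- by apply/prodf_neq0 => kb _; case: (hP kb).
move=> g gu /prodf_neq0 Pg m dm.
have le_N kb : (N g0 kb <= N g kb)%N by have [_ _ ->] := hP kb; rewrite ?Pg.
have eqN kb : N g0 kb = N g kb.
  (* Termwise inequalities between families with equal sums are equalities. *)
  have [le_sum] := leqif_sum (fun kb (_ : true) => leqif_eq (le_N kb)).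
  by rewrite eqn_leq le_sum (g0max g gu) => /esym/forallP/(_ kb)/eqP.
have lt_m : (mdeg m < d.+1)%N by rewrite dm.
have := eqN (BMultinom lt_m, true); rewrite /N /X.
rewrite (degree_part_pred (E g0) (m := BMultinom lt_m) dm).
rewrite (degree_part_pred (E g) (m := BMultinom lt_m) dm).
rewrite [X in (_ + X)%N = _](eqN (BMultinom lt_m, false)) => /addIn.
by rewrite [val _]/=; case: (E g m); case: (E g0 m).
Qed.

(** The open set may depend on [m] here; [Gin_generic] removes this dependence. *)
Definition generic_monomials m : Prop :=
  exists P g0, [/\ polynomial_function P, g0 \in unitmx, P g0 != 0
    & forall g, g \in unitmx -> P g != 0 -> E g m].

Lemma generic_degreeE d : exists P g0,
  [/\ polynomial_function P, g0 \in unitmx, P g0 != 0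
    & forall g, g \in unitmx -> P g != 0 ->
        forall m, mdeg m = d -> E g m <-> generic_monomials m].
Proof.
have [P [g0 [PP g0u Pg0 hP]]] := generic_degree d.
exists P, g0; split=> [|||g gu Pg m dm]; [exact: PP|exact: g0u|exact: Pg0|].
rewrite hP //; split=> [Em|].
  exists P, g0; split=> [|||g' g'u Pg']; [exact: PP|exact: g0u|exact: Pg0|].
  by rewrite (hP _ g'u Pg' _ dm).
case=> Q [h [PQ hu Qh hQ]].
have [C [Cu PC QC]] := generic_common PP PQ g0u Pg0 Qh.
by rewrite -(hP C) // hQ.
Qed.

Lemma generic_below D : exists P g0,
  [/\ polynomial_function P, g0 \in unitmx, P g0 != 0
    & forall g, g \in unitmx -> P g != 0 ->
        forall m, (mdeg m <= D)%N -> E g m <-> generic_monomials m].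
Proof.
elim: D => [|D [P [g [PP gu Pg hP]]]].
  have [P [g0 [PP g0u Pg0 hP]]] := generic_degreeE 0.
  by exists P, g0; split=> // g gu Pg m; rewrite leqn0 => /eqP; apply: hP.
have [Q [h [PQ hu Qh hQ]]] := generic_degreeE D.+1.
have [C [Cu PC QC]] := generic_common PP PQ gu Pg Qh.
exists (fun g => P g * Q g), C; split=> //.
- exact: polynomial_functionM.
- exact: mulf_neq0.
move=> g' g'u; rewrite mulf_eq0 negb_or => /andP[Pg' Qg'] m.
by rewrite leq_eqVlt ltnS => /orP[/eqP|]; [apply: hQ | apply: hP].
Qed.

End Order.

(** Both sides are the dimension of the degree d part of I, so exchanging the roles gives equality.
    Elements whose images under [g] have distinct initial monomials are independent, and remain so
    under [g']. *)
Lemma hilbert_le (tau tau' : rel 'X_{1..n}) d g g' :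
    is_term_order tau -> is_term_order tau' -> g \in unitmx -> g' \in unitmx ->
  (#|degree_part d predT (initial_monomials tau (gl_image g I))| <=
   #|degree_part d predT (initial_monomials tau' (gl_image g' I))|)%N.
Proof.
move=> htau htau' gu g'u; set S := degree_part d _ _.
have hS (m : 'X_{1..n < d.+1}) : m \in S ->
    mdeg (val m) = d /\ initial_monomials tau (gl_image g I) (val m).
  by case/andP=> /eqP.
have [h hh] := initial_basis hS gu.
rewrite -[X in (X <= _)%N]card_ord.
have := card_initial_ge htau' (V := gl_image g' I) (X := predT) (F := fun r => gl_act g' (h r)).
apply=> //; first exact: gl_image_ideal.
- by move=> r; exists (h r) => //; case: (hh r).
- by move=> r; apply: gl_act_homog; case: (hh r).
move=> v vn.
have Fk r : is_initial_monomial tau (gl_act g (h r)) (val (enum_val r : 'X_{1..n < d.+1})).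
  by have [] := hh r.
have [s fs] := initial_independent htau (@degree_part_inj _ S) Fk vn.
apply: NNPP => nu; move/eqP: fs; apply.
(* The substitution by [g *m invmx g'] turns a vanishing combination of the images under [g'] into
   one of the images under [g]. *)
set f := \sum_r _; have -> : f = gl_act (g *m invmx g') (\sum_r v r *: gl_act g' (h r)).
  rewrite gl_act_sum; apply: eq_bigr => r _.
  by rewrite gl_actZ gl_act_comp mulmxKV.
rewrite (_ : \sum_r _ = 0) ?gl_act0 ?mcoeff0 //.
apply/mpolyP => u; rewrite mcoeff0; apply/eqP/negPn/negP => fu.
by apply: nu; exists u.
Qed.

(** Generic monomials are generated in degrees at most some [D]. On an open set controlling these
    degrees all of them are initial, in every degree; there can be no others, because the Hilbert
    function leaves no room. *)
Theorem Gin_generic tau : is_term_order tau ->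
  exists P g0, [/\ polynomial_function P, g0 \in unitmx, P g0 != 0,
    forall g, g \in unitmx -> P g != 0 ->
      initial_monomials tau (gl_image g I) =1 initial_monomials tau (gl_image g0 I)
  & Gin tau I =
      fun f => {in msupp f, forall m, initial_monomials tau (gl_image g0 I) m}].
Proof.
move=> htau; pose G := generic_monomials tau.
have Gup m m' : G m -> (m <= m')%MM -> G m'.
  case=> P [g0 [PP g0u Pg0 hP]] /submK <-; exists P, g0; split=> // g gu Pg.
  by apply: initial_monomials_up (gl_image_ideal hI gu) _ => //; apply: hP.
have [D hD] := dickson G.
have [P [g0 [PP g0u Pg0 hP]]] := generic_below htau D.
have EG g : g \in unitmx -> P g != 0 ->
    forall m, initial_monomials tau (gl_image g I) m <-> G m.
  move=> gu Pg.
  have GE m : G m -> initial_monomials tau (gl_image g I) m.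
    case/hD=> m' [Gm' dm' /submK <-].
    by apply: initial_monomials_up (gl_image_ideal hI gu) _ => //; apply/hP.
  move=> m; split; last exact: GE.
  have [Q [h [PQ hu Qh hQ]]] := generic_degreeE htau (mdeg m).
  (* In the degree of [m], the initial monomials for a generic [h] are the generic ones, hence
     initial for [g]; equal cardinalities make the inclusion an equality. *)
  have sub : degree_part (mdeg m) predT (initial_monomials tau (gl_image h I))
      \subset degree_part (mdeg m) predT (initial_monomials tau (gl_image g I)).
    apply/subsetP => u /andP[/eqP du Eu]; rewrite inE du eqxx /=.
    by apply/GE/(hQ h).
  have [_] := subset_leqif_card sub.
  rewrite eqn_leq (subset_leq_card sub) (hilbert_le _ htau htau gu hu) => /esym/subsetP sup Em.
  have /sup : BMultinom (ltnSn (mdeg m)) \in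
      degree_part (mdeg m) predT (initial_monomials tau (gl_image g I)).
    by rewrite inE /= eqxx.
  by case/andP=> _ /(hQ h hu Qh) ; apply.
exists P, g0; split; [exact: PP|exact: g0u|exact: Pg0| |].
  by move=> g gu Pg m; apply/idP/idP => /EG Gm; apply/EG => //; apply: Gm.
set t := fun f => _.
apply: (generic_valueE charK _ polynomial_function_det1); first exact: unitmx_det.
apply/is_generic_valueE; exists P, g0.
split=> [|||g gu Pg]; [exact: PP|exact: g0u|exact: Pg0|].
apply: pred_ext => f.
apply: iff_trans (initial_idealE htau _ (gl_image_ideal hI gu)) _.
by split=> h m /h Em; apply/(EG _ _ _ m).2/(EG _ _ _ m).1/Em.
Qed.

End GenericInitialIdeal.

(** * Strong stability in characteristic 0 *)

Definition strongly_stable n (E : pred 'X_{1..n}) : Prop :=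
  forall u (s t : 'I_n), (s < t)%N -> E (u + U_(t))%MM -> E (u + U_(s))%MM.

Lemma mpoly_ring_ind n (R : nzRingType) (P : {mpoly R[n]} -> Prop) :
    (forall c, P c%:MP) -> (forall i, P 'X_i) ->
    (forall f g, P f -> P g -> P (f + g)) -> (forall f g, P f -> P g -> P (f * g)) ->
  forall f, P f.
Proof.
move=> PC PX PD PM; elim/mpolyind=> [|c m f _ _ Pf].
  by rewrite -(mpolyC0 n R); apply: PC.
apply: (PD _ _ _ Pf); rewrite -mul_mpolyC; apply: (PM _ _ (PC c)); rewrite mpolyXE_id.
elim/big_ind: _ => [|f' g' Pf' Pg'|i _]; first by rewrite -(mpolyC1 n R); apply: PC.
  exact: PM.
elim: (m i) => [|k IHk]; first by rewrite expr0 -(mpolyC1 n R); apply: PC.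
by rewrite exprS; apply: PM.
Qed.

Lemma coefM1 (R : nzRingType) (p q : {poly R}) a b :
  p`_0 = a -> q`_0 = b -> (p * q)`_1 = a * q`_1 + p`_1 * b.
Proof. by move=> <- <-; rewrite coefM big_ord_recr big_ord1. Qed.

Section Transvection.

Variables (n : nat) (K : fieldType) (s t : 'I_n).
Implicit Types (f : {mpoly K[n]}) (c : K).

(** With the convention of [gl_act], this sends x_t to x_t + c x_s and fixes the other variables. *)
Definition transvection c : 'M[K]_n := 1%:M + c *: delta_mx s t.

(* [gl_act (transvection c) f] as a polynomial in [c]. *)
Definition transvection_poly f : {poly {mpoly K[n]}} :=
  mmap (polyC \o @mpolyC n K)
    (fun i => ('X_i)%:P + (if i == t then ('X_s)%:P * 'X else 0)) f.

Lemma transvection_polyE c f : (transvection_poly f).[c%:MP] = gl_act (transvection c) f.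
Proof.
elim/mpoly_ring_ind: f => [a|i|f g IHf IHg|f g IHf IHg].
- by rewrite /transvection_poly mmapC /= hornerC /gl_act comp_mpolyC.
- rewrite /transvection_poly mmapX mmap1U gl_actXU (bigD1 i) //=.
  rewrite !mxE eqxx /=.
  have [->|it] := eqVneq i t.
    rewrite !hornerE /=.
    have [st|st] := eqVneq s t.
      rewrite big1 ?addr0 => [|j jt].
        by rewrite st /= mulr1 scalerDl scale1r -mul_mpolyC mulrC.
      by rewrite !mxE st (negPf jt) /= mulr0 addr0 scale0r.
    rewrite /= mulr0 addr0 scale1r (bigD1 s) //= big1 ?addr0.
      by rewrite !mxE (negPf st) !eqxx /= add0r mulr1 -mul_mpolyC mulrC.
    by move=> j /andP[jt js]; rewrite !mxE (negPf jt) (negPf js) /= mulr0 addr0 scale0r.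
  rewrite !hornerE big1 ?addr0 => [|j ji]; rewrite ?mxE.
    by rewrite scale1r.
  by rewrite (negPf ji) (negPf it) andbF mulr0 addr0 scale0r.
- by rewrite gl_actD -IHf -IHg /transvection_poly mmapD hornerD.
- by rewrite gl_actM -IHf -IHg /transvection_poly rmorphM hornerM.
Qed.

Lemma transvection_poly_coef0 f : (transvection_poly f)`_0 = f.
Proof.
rewrite -horner_coef0 -(mpolyC0 n K) transvection_polyE /transvection scale0r addr0.
exact: gl_act1.
Qed.

(** First-order Taylor expansion in c: both sides are derivations in [f] and agree on the
    variables. *)
Lemma transvection_poly_coef1 f : (transvection_poly f)`_1 = 'X_s * f^`M(t).
Proof.
elim/mpoly_ring_ind: f => [a|i|f g IHf IHg|f g IHf IHg].
- by rewrite /transvection_poly mmapC /= coefC mderivC mulr0.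
- rewrite /transvection_poly mmapX mmap1U coefD coefC add0r mderivX mnm1E.
  have [->|it] := eqVneq i t; last by rewrite coef0 scale0r mulr0.
  rewrite coefMX coefC /= scale1r.
  have -> : (U_(t) - U_(t) = 0 :> 'X_{1..n})%MM.
    by apply/mnmP => k; rewrite mnmBE subnn mnm0E.
  by rewrite mpolyX0 mulr1.
- by rewrite mderivD mulrDr -IHf -IHg /transvection_poly mmapD coefD.
rewrite mderivM mulrDr ['X_s * (_ * g)]mulrA -IHf ['X_s * _]mulrCA -IHg /transvection_poly rmorphM.
rewrite (coefM1 (transvection_poly_coef0 f) (transvection_poly_coef0 g)).
by rewrite addrC.
Qed.

Definition coef_poly f v : {poly K} := map_poly (mcoeff v) (transvection_poly f).

Lemma coef_polyE c f v : (coef_poly f v).[c] = (gl_act (transvection c) f)@_v.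
Proof.
rewrite -transvection_polyE /coef_poly /map_poly horner_poly horner_coef raddf_sum /=.
by apply: eq_bigr => i _; rewrite -rmorphXn /= [in RHS]mulrC mcoeffCM mulrC.
Qed.

Lemma coef_poly0 f v : (coef_poly f v)`_0 = f@_v.
Proof. by rewrite coef_map_id0 ?mcoeff0 // transvection_poly_coef0. Qed.

Lemma coef_poly1 f v : (coef_poly f v)`_1 = ('X_s * f^`M(t))@_v.
Proof. by rewrite coef_map_id0 ?mcoeff0 // transvection_poly_coef1. Qed.

End Transvection.

Section StronglyStable.

Variables (n : nat) (K : fieldType) (I : {mpoly K[n]} -> Prop) (tau : rel 'X_{1..n}).
Hypothesis charK : [pchar K]%R =i pred0.
Hypothesis hI : is_ideal I.
Hypothesis hIh : is_homogeneous I.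
Hypothesis htau : is_term_order tau.
Hypothesis hvar : decreasing_variables tau.

Let tau_anti a b : tau a b -> tau b a -> a = b.
Proof. by have [[_ h _ _] _] := htau => ab ba; apply: h; rewrite ab. Qed.
Let tau_trans a b c : tau a b -> tau b c -> tau a c.
Proof. by have [[_ _ h _] _] := htau; apply: h. Qed.
Let tau_add a b c : tau a b -> tau (a + c)%MM (b + c)%MM.
Proof. by have [_ [_ h]] := htau; apply: h. Qed.

Lemma term_order_cancel a b c : tau (a + c)%MM (b + c)%MM -> tau a b.
Proof.
have [[refl _ _ tot] _] := htau => abc; case/orP: (tot a b) => // ba.
have /addIm-> : (a + c = b + c)%MM by apply: tau_anti abc (tau_add c ba).
exact: refl.
Qed.

(* Suppose x_t u is the initial monomial of f in gI, but x_s u is not initial.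
   Together with elements of gI having the initial monomials above x_s u, the
   image of f under x_t -> x_t + c x_s, divided by c, would give for generic c
   one initial monomial too many above x_s u: on the monomials from x_s u on,
   the quotient specializes at c = 0 to x_s times the derivative of f by x_t,
   whose initial monomial is x_s u because of characteristic 0. *)
Theorem generic_strongly_stable P g0 :
    polynomial_function P -> g0 \in unitmx -> P g0 != 0 ->
    (forall g, g \in unitmx -> P g != 0 ->
      initial_monomials tau (gl_image g I) =1 initial_monomials tau (gl_image g0 I)) ->
  strongly_stable (initial_monomials tau (gl_image g0 I)).
Proof.
move=> PP g0u Pg0 hP u s t lt_st; set E := initial_monomials _ _ => Em.
have [//|nEm'] := boolP (E (u + U_(s))%MM); exfalso.
set m := (u + U_(t))%MM in Em; set m' := (u + U_(s))%MM in nEm'.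
have nst : s != t by rewrite -val_eqE neq_ltn lt_st.
have lt_mm' : tau m m'.
  rewrite /m /m' ![(u + _)%MM]addmC; apply: tau_add.
  have [[_ _ _ tot] _] := htau.
  by case/orP: (tot U_(t)%MM U_(s)%MM) => // st; case/negP: (hvar lt_st).
have neq_mm' : m != m' by rewrite eqm_add2l eq_mnm1 eq_sym.
pose d := mdeg m; have dm' : mdeg m' = d by rewrite /d !mdegD !mdeg1.
have [f [Vf [mf fmax] fd]] := initial_monomials_homog (gl_image_homogeneous hIh) Em.
pose S := degree_part d (tau m') E.
have hS (v : 'X_{1..n < d.+1}) : v \in S -> [/\ mdeg (val v) = d, tau m' (val v) & E (val v)].
  by case/and3P=> /eqP.
have [v vS|h hh] := initial_basis hIh (S := S) (g := g0) (tau := tau) _ g0u.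
  by have [dv _ Ev] := hS v vS.
(* Index 0 stands for [f], with the label [m'] that is not in [S]; the other indices stand for
   elements whose initial monomials are those of [S]. *)
pose N := #|S|.+1.
pose F (r : 'I_N) := if unlift ord0 r is Some r' then gl_act g0 (h r') else f.
pose kp (r : 'I_N) := if unlift ord0 r is Some r' then val (enum_val r' : 'X_{1..n < d.+1}) else m'.
have kpS (r' : 'I_#|S|) : E (val (enum_val r' : 'X_{1..n < d.+1})).
  by have [] := hS _ (enum_valP r').
have kp_inj : injective kp.
  move=> r r'; rewrite /kp.
  case: unliftP => [a|] ->; case: unliftP => [b|] -> //.
  - by move/val_inj/enum_val_inj->.
  - by move=> ab; move: nEm'; rewrite -ab kpS.
  - by move=> ab; move: nEm'; rewrite ab kpS.
have kpX r : tau m' (kp r).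
  rewrite /kp; case: unliftP => [a|] _; last by have [[->]] := htau.
  by have [] := hS _ (enum_valP a).
(* No monomial of [f] reaches [m'], so the coefficients of its image at the labels vanish at c = 0;
   hence the division by c, performed by [drop_poly 1], is exact. *)
have f0 v : tau m' v -> f@_v = 0.
  move=> m'v; apply/memN_msupp_eq0/negP => /fmax vm.
  by case/eqP: neq_mm'; apply: tau_anti => //; apply: tau_trans m'v vm.
pose G (r : 'I_N) := if unlift ord0 r is Some r' then gl_act g0 (h r') else 'X_s * f^`M(t).
pose M : 'M[{poly K}]_N := \matrix_(r, a)
  if unlift ord0 r is Some r' then coef_poly s t (F r) (kp a)
  else drop_poly 1 (coef_poly s t f (kp a)).
have M0 : (\det M).[0] != 0.
  change (horner_eval 0 (\det M) != 0).
  rewrite -det_map_mx; apply/det_independent => v vn.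
  have [||a ha] := triangular_independent htau (k := kp) (c := fun r u => (G r)@_u) kp_inj _ _ vn.
  - move=> r; rewrite /G /kp; case: unliftP => [a|] _.
      by rewrite -mcoeff_msupp; have [_ _ []] := hh a.
    (* This coefficient is that of [m] in [f] times u_t + 1, nonzero in characteristic 0. *)
    rewrite mulrC /m' addmC mcoeffMX mcoeff_deriv -/m -mulr_natr mulf_neq0 //.
      by rewrite -mcoeff_msupp.
    by rewrite ((pcharf0P K).1 charK).
  - move=> r r' rr'; rewrite /G {1}/kp; case: unliftP => [a ra|ra] krk.
      apply/memN_msupp_eq0/negP => kr'.
      have [_ _ [_ /(_ _ kr') kr'a]] := hh a.
      case/eqP: rr'; apply: kp_inj; rewrite {1}/kp ra liftK.
      exact: tau_anti.
    have m'r' : m' != kp r'.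
      apply: contra_neq rr' => m'r'; apply: kp_inj.
      by rewrite -m'r' ra /kp unlift_none.
    apply/eqP; rewrite mcoeff_eq0; apply/negP => /msuppM_le /allpairsP[[a b] /= []].
    rewrite msuppX inE => /eqP-> bf kab.
    case/eqP: m'r'; apply: tau_anti => //; rewrite kab addmC; apply: tau_add.
    apply: (@term_order_cancel _ _ U_(t)%MM); apply: fmax.
    move: bf; rewrite !mcoeff_msupp mcoeff_deriv; apply: contraNneq => ->.
    by rewrite mul0rn.
  exists a; move: ha; congr (_ != 0); apply: eq_bigr => r _; congr (_ * _).
  rewrite !mxE /G /F /= /horner_eval horner_coef0; case: unliftP => [b|] _.
    by rewrite coef_poly0.
  by rewrite coef_drop_poly add0n coef_poly1.
(* The value of c must also keep the moved matrix invertible and inside the open set where the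
   initial monomials are those for [g0]; this holds at c = 0, hence off finitely many values. *)
have PdP : polynomial_function (fun g => \det g * P g).
  exact: polynomial_functionM (polynomial_function_det1 n K) PP.
have [q hq] := polynomial_function_line g0 (delta_mx s t *m g0) PdP.
have q0 : q != 0.
  apply: contraTneq g0u => q0; apply/negP => /unitmx_det dg0.
  have := hq 0; rewrite q0 horner0 scale0r addr0 => /esym/eqP.
  by rewrite mulf_eq0 (negPf dg0) (negPf Pg0).
have detM0 : \det M != 0 by apply: contraNneq M0 => ->; rewrite horner0.
have [c] := poly_nonroot charK (mulf_neq0 (mulf_neq0 detM0 q0) (negbT (polyX_eq0 K))).
rewrite !hornerM hornerX !mulf_eq0 !negb_or hq => /andP[/andP[Mc]].
pose gc := transvection s t c *m g0.
have -> : g0 + c *: (delta_mx s t *m g0) = gc.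
  by rewrite /gc /transvection mulmxDl mul1mx scalemxAl.
rewrite mulf_eq0 negb_or => /andP[/unitmx_det gcu Pgc] c0.
suff : (N <= #|S|)%N by rewrite ltnn.
have -> : #|S| = #|degree_part d (tau m') (initial_monomials tau (gl_image gc I))|.
  by apply: eq_card => v; rewrite !inE (hP gc gcu Pgc).
rewrite -[X in (X <= _)%N]card_ord.
have := card_initial_ge htau (V := gl_image gc I) (X := tau m')
  (F := fun r => gl_act (transvection s t c) (F r)).
apply; first exact: gl_image_ideal.
- move=> r; apply: gl_image_comp; rewrite /F; case: unliftP => [a|] _ //.
  by have [] := hh a; exists (h a).
- move=> r; apply: gl_act_homog; rewrite /F; case: unliftP => [a|] _ //.
  by have [_ ? _] := hh a; apply: gl_act_homog.
- by apply: (upper_initial (tau := tau)) => v w; apply: tau_trans.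
move=> v [r0 vr0].
have Mc' : \det (map_mx (horner_eval c) M) != 0 by rewrite det_map_mx.
(* The row of [f] in [M] was divided by c, so its weight is multiplied by c. *)
pose w r := v r * (if unlift ord0 r is Some _ then 1 else c).
have wn : exists r, w r != 0.
  by exists r0; rewrite /w mulf_neq0 //; case: unliftP => [a|] _ //; apply: oner_neq0.
have [a ha] := (det_independent _).1 Mc' w wn.
exists (kp a) => //; move: ha; congr (_ != 0); rewrite raddf_sum /=.
apply: eq_bigr => r _; rewrite mcoeffZ /w -mulrA; congr (_ * _).
rewrite !mxE /F /= /horner_eval; case: unliftP => [b|] _; first by rewrite mul1r coef_polyE.
rewrite -coef_polyE -[in RHS](poly_take_drop 1 (coef_poly s t f (kp a))).
rewrite hornerD hornerM hornerXn expr1 mulrC /take_poly horner_poly big_ord1.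
by rewrite coef_poly0 f0 // mul0r add0r.
Qed.

End StronglyStable.

(** * The reverse lexicographic order *)

Section Degrevlex.

Variable n : nat.
Implicit Types (a b c m u : 'X_{1..n}).

Definition revlex_lt a b : bool :=
  [exists k : 'I_n, (b k < a k)%N && [forall l : 'I_n, (k < l)%N ==> (a l == b l)]].

Lemma revlex_ltP a b :
  reflect (exists k : 'I_n, (b k < a k)%N /\ forall l : 'I_n, (k < l)%N -> a l = b l)
          (revlex_lt a b).
Proof.
apply: (iffP existsP) => [[k /andP[ak /forallP kl]]|[k [ak kl]]]; exists k.
  by split=> // l lk; apply/eqP; apply: implyP (kl l) lk.
by rewrite ak; apply/forallP => l; apply/implyP => /kl->.
Qed.

Lemma revlex_lt_trans : transitive revlex_lt.
Proof.
move=> b a c /revlex_ltP[k [ak kl]] /revlex_ltP[k' [bk kl']]; apply/revlex_ltP.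
have [kk'|kk'|kk'] := ltngtP k k'.
- exists k'; split=> [|l ll]; first by rewrite kl.
  by rewrite kl ?kl' //; apply: ltn_trans ll.
- exists k; split=> [|l ll]; first by rewrite -kl'.
  by rewrite kl ?kl' //; apply: ltn_trans ll.
- move/val_inj: kk' => kk'; subst k'; exists k; split=> [|l ll].
    exact: ltn_trans bk ak.
  by rewrite kl ?kl'.
Qed.

Lemma revlex_lt_irr a : revlex_lt a a = false.
Proof. by apply/negbTE/negP => /revlex_ltP[k []]; rewrite ltnn. Qed.

Lemma revlex_lt_total a b : a != b -> revlex_lt a b || revlex_lt b a.
Proof.
move=> ab; have [k0 ak0] : exists k, a k != b k.
  apply: NNPP => h; case/eqP: ab; apply/mnmP => k; apply/eqP/negPn/negP => kab.
  by apply: h; exists k.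
case: (@arg_maxnP _ k0 (fun k => a k != b k) val ak0) => k akb kmax.
have eq_l (l : 'I_n) : (k < l)%N -> a l = b l.
  by move=> kl; apply/eqP/negPn/negP => /kmax /=; rewrite leqNgt kl.
case: (ltngtP (a k) (b k)) akb => // lt_k _; apply/orP; [right|left].
  by apply/revlex_ltP; exists k; split=> // l /eq_l.
by apply/revlex_ltP; exists k.
Qed.

Lemma degrevlexE a b :
  degrevlex a b = (mdeg a < mdeg b)%N || (mdeg a == mdeg b) && ((a == b) || revlex_lt a b).
Proof. by []. Qed.

Lemma degrevlex_term_order : is_term_order (@degrevlex n).
Proof.
split; [split|split].
- by move=> a; rewrite degrevlexE !eqxx orbT.
- move=> a b; rewrite !degrevlexE; case: ltngtP => //= _.
  rewrite eq_sym; case: eqP => //= _ /andP[ab ba].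
  by have := revlex_lt_trans ab ba; rewrite revlex_lt_irr.
- move=> b a c; rewrite !degrevlexE.
  case: (ltngtP (mdeg a) (mdeg b)) => [ab _|//|->].
    case/orP=> [bc|/andP[/eqP<- _]]; last by rewrite ab.
    by rewrite (ltn_trans ab bc).
  case: (ltngtP (mdeg b) (mdeg c)) => //= _.
  case/predU1P=> [->//|ab] /predU1P[<-|bc]; first by rewrite ab orbT.
  by rewrite (revlex_lt_trans ab bc) orbT.
- move=> a b; rewrite !degrevlexE; case: ltngtP => //= _.
  have [->|ab] := eqVneq a b; rewrite ?eqxx //=.
  by rewrite revlex_lt_total.
- move=> a; rewrite degrevlexE mdeg0; have [/eqP|//] := posnP (mdeg a).
  by rewrite mdeg_eq0 => /eqP->; rewrite mdeg0 !eqxx.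
- move=> a b c; rewrite !degrevlexE !mdegD ltn_add2r eqn_add2r eqm_add2r.
  case: ltngtP => //= _; case: eqP => //= _ /revlex_ltP[k [bk kl]].
  apply/revlex_ltP; exists k; rewrite !mnmDE ltn_add2r; split=> // l /kl.
  by rewrite !mnmDE => ->.
Qed.

Lemma degrevlex_decreasing : decreasing_variables (@degrevlex n).
Proof.
move=> i j ij; rewrite degrevlexE !mdeg1 ltnn eqxx /= eq_mnm1 negb_or.
rewrite -val_eqE neq_ltn ij /=; apply/negP => /revlex_ltP[k [jk kl]].
have ik : i = k by move: jk; rewrite !mnm1E; do 2!case: eqP.
move: (kl j); rewrite -ik => /(_ ij); rewrite !mnm1E eqxx.
by case: eqP ij => // ->; rewrite ltnn.
Qed.

Definition first_variables q : pred 'X_{1..n} :=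
  fun m => [forall l : 'I_n, (q <= l)%N ==> (m l == 0%N)].

Lemma first_variablesP q m :
  reflect (forall l : 'I_n, (q <= l)%N -> m l = 0%N) (first_variables q m).
Proof.
apply: (iffP forallP) => h l; first by move=> ql; apply/eqP; apply: implyP (h l) ql.
by apply/implyP => /h->.
Qed.

(** In equal degrees, at the last place where u and m differ u has the larger exponent, so this
    place is below q; beyond it m agrees with u. *)
Lemma degrevlex_first_variables (K : fieldType) q d (f : {mpoly K[n]}) m u :
    f \is d.-homog -> u \in msupp f -> first_variables q u ->
  is_initial_monomial (@degrevlex n) f m -> first_variables q m.
Proof.
move=> fd uf uq [mf /(_ _ uf)]; rewrite degrevlexE.
rewrite (dhomogP _ _ _ fd _ uf) (dhomogP _ _ _ fd _ mf) ltnn eqxx /=.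
case/predU1P=> [<-//|/revlex_ltP[k [mk kl]]].
move/first_variablesP: uq => uq; apply/first_variablesP => l ql.
have kq : (k < q)%N by rewrite ltnNge; apply/negP => /uq uk; rewrite uk in mk.
by rewrite -kl ?uq //; apply: leq_trans ql.
Qed.

End Degrevlex.

Definition monomial_ideal n (K : fieldType) (E : pred 'X_{1..n}) : {mpoly K[n]} -> Prop :=
  fun f => {in msupp f, forall m, E m}.

Definition up_closed n (E : pred 'X_{1..n}) : Prop := forall u m, E m -> E (u + m)%MM.

(* In revlex, the leading monomial of f avoids the last variables as soon as
   some monomial of f does: killing the last variables thus commutes with
   taking initial ideals, while for another order it can only lose initial
   monomials. *)
Theorem Gin_comparison n (K : fieldType) (I : {mpoly K[n]} -> Prop) (tau : rel 'X_{1..n}) :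
    [pchar K]%R =i pred0 -> is_ideal I -> is_homogeneous I ->
    is_term_order tau -> decreasing_variables tau ->
  exists E E' : pred 'X_{1..n},
    [/\ Gin (@degrevlex n) I = monomial_ideal E, Gin tau I = monomial_ideal E',
      up_closed E /\ up_closed E', strongly_stable E /\ strongly_stable E'
      & forall d,
        #|degree_part d predT E| = #|degree_part d predT E'| /\
        forall q, (#|degree_part d (first_variables q) E'| <=
                   #|degree_part d (first_variables q) E|)%N].
Proof.
move=> charK hI hIh htau hvar.
have hrl := degrevlex_term_order n.
have [P [g0 [PP g0u Pg0 hP GP]]] := Gin_generic charK hI hIh hrl.
have [Q [g1 [PQ g1u Qg1 hQ GQ]]] := Gin_generic charK hI hIh htau.
have ssP := generic_strongly_stable charK hI hIh hrl (@degrevlex_decreasing n) PP g0u Pg0 hP.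
have ssQ := generic_strongly_stable charK hI hIh htau hvar PQ g1u Qg1 hQ.
(* One [g] generic for both orders: both sets of monomials become initial monomials of the same
   ideal gI. *)
have [g [gu Pg Qg]] := generic_common charK PP PQ g0u Pg0 Qg1.
exists (initial_monomials (@degrevlex n) (gl_image g0 I)), (initial_monomials tau (gl_image g1 I)).
split=> //.
  by split=> u m; apply: initial_monomials_up => //; apply: gl_image_ideal.
move=> d; split=> [|q].
  by apply/eqP; rewrite eqn_leq; apply/andP; split; apply: hilbert_le.
set S := degree_part d _ _.
have hS (m : 'X_{1..n < d.+1}) : m \in S ->
    [/\ mdeg (val m) = d, first_variables q (val m)
      & initial_monomials tau (gl_image g I) (val m)].
  by case/and3P=> /eqP ? ?; rewrite -(hQ g gu Qg).
have [m mS|h hh] := initial_basis hIh (S := S) (g := g) (tau := tau) _ gu.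
  by have [dm _ Em] := hS m mS.
have -> : #|degree_part d (first_variables q) (initial_monomials (@degrevlex n) (gl_image g0 I))| =
    #|degree_part d (first_variables q) (initial_monomials (@degrevlex n) (gl_image g I))|.
  by apply: eq_card => v; rewrite !inE (hP g gu Pg).
rewrite -[X in (X <= _)%N]card_ord.
have := card_initial_ge hrl (V := gl_image g I) (X := first_variables q)
  (F := fun r => gl_act g (h r)).
apply; first exact: gl_image_ideal.
- by move=> r; exists (h r) => //; case: (hh r).
- by move=> r; apply: gl_act_homog; case: (hh r).
- by move=> f m u; apply: degrevlex_first_variables.
move=> v vn.
have Fk r : is_initial_monomial tau (gl_act g (h r)) (val (enum_val r : 'X_{1..n < d.+1})).
  by have [] := hh r.
have [s fs] := initial_independent htau (@degree_part_inj _ _ S) Fk vn.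
exists (val (enum_val s : 'X_{1..n < d.+1})) => //.
by have [] := hS _ (enum_valP s).
Qed.

(** * Koszul homology and changes of forms *)

Section QuotientDimension.

Variables (K : fieldType) (V : lmodType K).
Implicit Types (Z B : V -> Prop).

Definition is_subspace B : Prop :=
  [/\ B 0, forall x y, B x -> B y -> B (x + y) & forall a x, B x -> B (a *: x)].

Lemma subspace_sum B (T : Type) (r : seq T) (C : pred T) (F : T -> V) :
  is_subspace B -> (forall i, C i -> B (F i)) -> B (\sum_(i <- r | C i) F i).
Proof. by move=> [B0 BD _] BF; elim/big_ind: _. Qed.

Lemma has_quotient_dim_le Z B d d' :
  is_subspace B -> has_quotient_dim Z B d -> has_quotient_dim Z B d' -> (d' <= d)%N.
Proof.
move=> sB [v [_ _ vsp]] [w [wZ wind _]]; rewrite leqNgt; apply/negP => lt_dd'.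
have /fin_all_exists[a ha] k : exists a : 'I_d -> K, B (w k - \sum_l a l *: v l).
  exact: vsp (wZ k).
pose M := \matrix_(k < d', l < d) a k l.
have : kermx M != 0.
  rewrite kermx_eq0 /row_free neq_ltn; apply/orP; left.
  exact: leq_ltn_trans (rank_leq_col M) lt_dd'.
case/rowV0Pn=> u /sub_kermxP uM /eqP nu; apply: nu; apply/rowP => k; rewrite mxE.
apply: (wind (fun k => u 0 k)).
have -> : \sum_k u 0 k *: w k = \sum_k u 0 k *: (w k - \sum_l a k l *: v l).
  under [RHS]eq_bigr => i _ do rewrite scalerBr.
  rewrite sumrB [X in _ - X](_ : _ = 0) ?subr0 //.
  under eq_bigr => i _ do rewrite scaler_sumr.
  rewrite exchange_big big1 //= => l _.
  have /rowP/(_ l) := uM; rewrite !mxE => uMl.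
  rewrite -[RHS](scale0r (v l)) -uMl scaler_suml.
  by apply: eq_bigr => i _; rewrite scalerA mxE.
by apply: subspace_sum => // i _; case: sB => _ _; apply.
Qed.

Lemma quotient_dimE Z B d :
  is_subspace B -> has_quotient_dim Z B d -> quotient_dim Z B = d.
Proof.
move=> sB hd; have hq : has_quotient_dim Z B (quotient_dim Z B).
  by apply: epsilon_spec; exists d.
by apply/eqP; rewrite eqn_leq (has_quotient_dim_le sB hd hq) (has_quotient_dim_le sB hq hd).
Qed.

Lemma has_quotient_dim_fin Z B (T : finType) (v : T -> V) :
    (forall k, Z (v k)) ->
    (forall a : T -> K, B (\sum_k a k *: v k) -> forall k, a k = 0) ->
    (forall z, Z z -> exists a : T -> K, B (z - \sum_k a k *: v k)) ->
  has_quotient_dim Z B #|T|.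
Proof.
have re (F : T -> V) : \sum_k F k = \sum_(k < #|T|) F (enum_val k).
  rewrite (reindex (fun r : 'I_#|T| => enum_val r)) //=.
  by apply: onW_bij; exists enum_rank; [apply: enum_valK|apply: enum_rankK].
move=> vZ vind vsp; exists (fun k => v (enum_val k)); split=> // [a Ba k|z /vsp[a Ba]].
  rewrite -[k]enum_valK; apply: (vind (fun t => a (enum_rank t))); rewrite re.
  by under eq_bigr => i _ do rewrite enum_valK.
by exists (fun k => a (enum_val k)); rewrite re in Ba.
Qed.

Lemma has_quotient_dim_transfer Z B Z' B' (T : V -> V) d :
    (forall x y, T (x + y) = T x + T y) -> (forall a x, T (a *: x) = a *: T x) ->
    (forall x, Z x -> Z' (T x)) -> (forall z', Z' z' -> exists2 z, Z z & T z = z') ->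
    (forall x, B x <-> B' (T x)) ->
  has_quotient_dim Z B d -> has_quotient_dim Z' B' d.
Proof.
move=> TD TZ ZT Zsurj BT [v [vZ vind vsp]].
have T0 : T 0 = 0 by have := TZ 0 0; rewrite !scale0r.
have Tsum (a : 'I_d -> K) : T (\sum_k a k *: v k) = \sum_k a k *: T (v k).
  by rewrite (big_morph T TD T0); apply: eq_bigr => k _; rewrite TZ.
exists (T \o v); split=> [k|a|z' /Zsurj[z Zz <-]].
  exact: ZT.
  by rewrite /= -Tsum => /BT; apply: vind.
have [a Ba] := vsp z Zz; exists a; rewrite /= -Tsum.
by rewrite -[- _]scaleN1r -TZ -TD scaleN1r; apply/BT.
Qed.

End QuotientDimension.

(** * Contraction and exterior multiplication *)

Section KoszulOperators.

Variables (R : comNzRingType) (p : nat).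
Implicit Types (s t r : 'I_p) (S : {set 'I_p}) (c : {ffun {set 'I_p} -> R}).

Definition koszul_sign s S : R := (-1) ^+ #|[set t in S | (t < s)%N]|.

Definition contraction s c : {ffun {set 'I_p} -> R} :=
  [ffun S : {set 'I_p} => if s \in S then 0 else koszul_sign s S * c (s |: S)].

Definition wedge s c : {ffun {set 'I_p} -> R} :=
  [ffun S : {set 'I_p} => if s \in S then koszul_sign s S * c (S :\ s) else 0].

Lemma koszul_signU r s S : r \notin S ->
  koszul_sign s (r |: S) = (-1) ^+ (r < s)%N * koszul_sign s S.
Proof.
move=> rS; rewrite /koszul_sign -exprD; congr (_ ^+ _).
rewrite (cardsD1 r) !inE eqxx /=; congr (_ + _)%N.
apply: eq_card => t; rewrite !inE; case: eqP => // -> /=.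
by rewrite (negPf rS).
Qed.

Lemma koszul_signD r s S : s \in S ->
  koszul_sign r S = (-1) ^+ (s < r)%N * koszul_sign r (S :\ s).
Proof. by move=> sS; rewrite -koszul_signU ?setD1K // !inE eqxx. Qed.

Lemma koszul_signK s S x : koszul_sign s S * (koszul_sign s S * x) = x.
Proof. by rewrite mulrA -expr2 sqrr_sign mul1r. Qed.

Lemma koszul_sign_ord r s : r != s -> (-1) ^+ (r < s)%N = - (-1) ^+ (s < r)%N :> R.
Proof. by rewrite -val_eqE; case: ltngtP; rewrite // opprK. Qed.

Lemma contraction_sqr s c : contraction s (contraction s c) = 0.
Proof. by apply/ffunP => S; rewrite !ffunE !inE eqxx /= mulr0 if_same. Qed.

Lemma contraction_anticomm r s c : r != s ->
  contraction r (contraction s c) = - contraction s (contraction r c).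
Proof.
move=> rs; apply/ffunP => S; rewrite !ffunE !inE (negPf rs) eq_sym (negPf rs) /=.
case: ifPn => rS; case: ifPn => sS; rewrite ?mulr0 ?oppr0 // !koszul_signU //.
by rewrite (koszul_sign_ord rs) setUCA; ring.
Qed.

(** The Clifford relation between contraction by e_r and multiplication by e_s. *)
Lemma contraction_wedge r s c :
  contraction r (wedge s c) = (if r == s then c else 0) - wedge s (contraction r c).
Proof.
apply/ffunP => S; rewrite !ffunE; have [->|rs] := eqVneq r s.
  rewrite !inE !eqxx /=; case: ifPn => sS; rewrite ?sub0r ?subr0.
    by rewrite (koszul_signD s sS) setD1K // ltnn mul1r koszul_signK subrr.
  by rewrite koszul_signU // ltnn mul1r koszul_signK setU1K.
rewrite ffunE !inE (negPf rs) eq_sym (negPf rs) /= sub0r.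
case: ifPn => rS; case: ifPn => sS; rewrite ?mulr0 ?oppr0 //.
rewrite koszul_signU // (koszul_signD r sS) (koszul_sign_ord rs).
have -> : (r |: S) :\ s = r |: (S :\ s).
  by apply/setP => t; rewrite !inE; case: eqP => // ->; rewrite eq_sym (negPf rs).
by case: (s < r)%N; rewrite ?expr1 ?expr0; ring.
Qed.

End KoszulOperators.
Lemma sum_antisymmetric (V : zmodType) (p : nat) (f : 'I_p -> 'I_p -> V) :
  (forall r, f r r = 0) -> (forall r s, r != s -> f r s = - f s r) -> \sum_r \sum_s f r s = 0.
Proof.
move=> f0 fN.
have split_f r : \sum_s f r s = \sum_(s < p | (s < r)%N) f r s + \sum_(s < p | (r < s)%N) f r s.
  rewrite (bigID (fun s : 'I_p => s < r)%N) /=; congr (_ + _).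
  rewrite (bigID (fun s => s == r)) /= big1 ?add0r => [|s /andP[_ /eqP->]] //.
  by apply: eq_bigl => s; rewrite -leqNgt -val_eqE /= eq_sym ltn_neqAle andbC.
under eq_bigr => r _ do rewrite split_f.
rewrite big_split /= [X in _ + X](exchange_big_dep xpredT) //= -big_split /=.
apply: big1 => r _; rewrite -big_split /=; apply: big1 => s sr.
by rewrite fN ?addNr // -val_eqE neq_ltn sr orbT.
Qed.

Lemma in_degree_gl_act n (K : fieldType) (d : int) (g : 'M[K]_n) (f : {mpoly K[n]}) :
  in_degree d f -> in_degree d (gl_act g f).
Proof.
case: d => d df; last first.
  suff -> : f = 0 by rewrite gl_act0 => m; rewrite msupp0.
  apply: msuppnil0; case fE: (msupp f) => [//|m s].
  by have := df m; rewrite fE mem_head => /(_ isT).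
have fd : f \is d.-homog by apply/dhomogP => m /df [].
by move=> m /(dhomogP _ _ _ (gl_act_homog g fd)) ->.
Qed.

Section KoszulComplex.

Variables (n : nat) (K : fieldType) (J : {mpoly K[n]} -> Prop) (p : nat).
Hypothesis hJ : is_ideal J.

Local Notation chains := {ffun {set 'I_p} -> {mpoly K[n]}}.
Implicit Types (A B : 'M[K]_(p, n)) (c : chains) (T : chains -> chains) (S : {set 'I_p}).

Lemma chainD c c' S : (c + c') S = c S + c' S. Proof. by rewrite ffunE. Qed.
Lemma chainB c c' S : (c - c') S = c S - c' S. Proof. by rewrite !ffunE. Qed.

Lemma chainZ (a : K) c S : (a *: c) S = a *: c S. Proof. by rewrite ffunE. Qed.

Lemma koszul_diffE A c S :
  koszul_diff A c S = \sum_s linear_form A s * contraction s c S.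
Proof.
rewrite ffunE big_mkcond; apply: eq_bigr => s _; rewrite ffunE.
by case: (s \in S); rewrite /= ?mulr0 // -mulrA mulrCA.
Qed.

Lemma koszul_diffD A c c' : koszul_diff A (c + c') = koszul_diff A c + koszul_diff A c'.
Proof.
apply/ffunP => S; rewrite [RHS]ffunE !koszul_diffE -big_split; apply: eq_bigr => s _ /=.
by rewrite !ffunE -mulrDr; case: (s \in S); rewrite ?addr0 // -mulrDr.
Qed.

Lemma koszul_diffZ A (a : K) c : koszul_diff A (a *: c) = a *: koszul_diff A c.
Proof.
apply/ffunP => S; rewrite [RHS]ffunE !koszul_diffE scaler_sumr; apply: eq_bigr => s _.
by rewrite !ffunE scalerAr; case: (s \in S); rewrite ?scaler0 // scalerAr.
Qed.

Lemma koszul_diffB A c c' : koszul_diff A (c - c') = koszul_diff A c - koszul_diff A c'.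
Proof. by rewrite koszul_diffD -scaleN1r koszul_diffZ scaleN1r. Qed.

(** Contractions anticommute while the forms commute, so the terms for (r, s) and (s, r) cancel. *)
Lemma koszul_diff_sqr A c : koszul_diff A (koszul_diff A c) = 0.
Proof.
apply/ffunP => S; rewrite koszul_diffE [RHS]ffunE.
have -> : \sum_r linear_form A r * contraction r (koszul_diff A c) S =
    \sum_r \sum_s linear_form A r * linear_form A s * contraction r (contraction s c) S.
  apply: eq_bigr => r _; rewrite ffunE; case: ifP => rS.
    by rewrite mulr0 big1 // => s _; rewrite ffunE rS mulr0.
  rewrite koszul_diffE !mulr_sumr; apply: eq_bigr => s _.
  by rewrite [in RHS]ffunE rS; ring.
apply: sum_antisymmetric => [r|r s rs]; first by rewrite contraction_sqr ffunE mulr0.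
by rewrite contraction_anticomm // ffunE mulrN [linear_form A r * _]mulrC.
Qed.

Definition koszul_hom A B T : Prop :=
  [/\ {morph T : x y / x + y}, forall (a : K) x, T (a *: x) = a *: T x,
      forall i j c, koszul_chain i j c -> koszul_chain i j (T c),
      forall c, (forall S, J (c S)) -> forall S, J (T c S)
    & forall c, koszul_diff B (T c) = T (koszul_diff A c)].

Lemma koszul_hom_cycle A B T i j c :
  koszul_hom A B T -> koszul_cycle J A i j c -> koszul_cycle J B i j (T c).
Proof.
move=> [_ _ Tch TJ Td] [ch Jc]; split; first exact: Tch.
by rewrite Td; apply: TJ.
Qed.

Lemma koszul_hom_boundary A B T i j c :
  koszul_hom A B T -> koszul_boundary J A i j c -> koszul_boundary J B i j (T c).
Proof.
move=> [TD TZ Tch TJ Td] [ch [b chb Jb]]; split; first exact: Tch.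
exists (T b); first exact: Tch.
have Jb' S : J ((c - koszul_diff A b) S) by rewrite chainB.
by move=> S; have := TJ _ Jb' S; rewrite TD -scaleN1r TZ scaleN1r -Td chainB.
Qed.

(** Not an inequality: the homology dimension for A is transported unchanged to B. One direction
    suffices to move a computed dimension from one sequence to another, and composes easily. *)
Definition koszul_le A B : Prop := forall i j d,
  has_quotient_dim (koszul_cycle J A i j) (koszul_boundary J A i j) d ->
  has_quotient_dim (koszul_cycle J B i j) (koszul_boundary J B i j) d.

Lemma koszul_le_iso A B T T' :
  koszul_hom A B T -> koszul_hom B A T' -> cancel T T' -> cancel T' T -> koszul_le A B.
Proof.
move=> hT hT' TK T'K i j d; have [TD TZ _ _ _] := hT.
apply: has_quotient_dim_transfer TD TZ _ _ _.
- by move=> c; apply: koszul_hom_cycle.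
- by move=> c Zc; exists (T' c); rewrite ?T'K //; apply: koszul_hom_cycle Zc.
move=> c; split; first exact: koszul_hom_boundary.
by move=> Bc; rewrite -[c]TK; apply: koszul_hom_boundary Bc.
Qed.

Lemma koszul_chain0 i j : koszul_chain i j (0 : chains).
Proof. by move=> S; rewrite ffunE; case: ifP => // _ m; rewrite msupp0. Qed.

Lemma koszul_chainD i j c c' :
  koszul_chain i j c -> koszul_chain i j c' -> koszul_chain i j (c + c').
Proof.
move=> hc hc' S; rewrite chainD; have := hc S; have := hc' S; case: ifP => _.
  by move=> dc' dc m /msuppD_le; rewrite mem_cat => /orP[/dc|/dc'].
by move=> -> ->; rewrite addr0.
Qed.

Lemma koszul_chainZ i j (a : K) c : koszul_chain i j c -> koszul_chain i j (a *: c).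
Proof.
move=> hc S; rewrite chainZ; have := hc S; case: ifP => _.
  by move=> dc m /msuppZ_le/dc.
by move=> ->; rewrite scaler0.
Qed.

Lemma koszul_chainB i j c c' :
  koszul_chain i j c -> koszul_chain i j c' -> koszul_chain i j (c - c').
Proof.
by move=> hc hc'; apply: koszul_chainD => //; rewrite -scaleN1r; apply: koszul_chainZ.
Qed.

Lemma koszul_boundary_subspace A i j : is_subspace (koszul_boundary J A i j).
Proof.
split.
- split; first exact: koszul_chain0.
  exists 0; first exact: koszul_chain0.
  move=> S; rewrite -(scale0r 0) koszul_diffZ !scale0r !ffunE subr0.
  exact: ideal0 hJ.
- move=> x y [hx [b hb Jb]] [hy [b' hb' Jb']]; split; first exact: koszul_chainD.
  exists (b + b'); first exact: koszul_chainD.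
  move=> S; rewrite koszul_diffD !chainD opprD addrACA.
  exact: idealD hJ (Jb S) (Jb' S).
move=> a x [hx [b hb Jb]]; split; first exact: koszul_chainZ.
exists (a *: b); first exact: koszul_chainZ.
move=> S; rewrite koszul_diffZ !chainZ -scalerBr.
exact: idealZ hJ (Jb S).
Qed.

Lemma koszul_homology_dimE A i j d :
  has_quotient_dim (koszul_cycle J A i j) (koszul_boundary J A i j) d ->
  koszul_homology_dim J i j A = d.
Proof. exact/quotient_dimE/koszul_boundary_subspace. Qed.

Lemma koszul_le_trans A B C : koszul_le A B -> koszul_le B C -> koszul_le A C.
Proof. by move=> hAB hBC i j d /hAB/hBC. Qed.

(** Applying [g] to the coefficients of chains carries the forms of A to their images, which are the
    rows of A g^T; as [g] and its inverse preserve J, this is an isomorphism over R/J. *)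
Lemma koszul_le_gl_act A (g g' : 'M[K]_n) :
    g *m g' = 1%:M -> g' *m g = 1%:M ->
    (forall f, J f -> J (gl_act g f)) -> (forall f, J f -> J (gl_act g' f)) ->
  koszul_le A (A *m g^T).
Proof.
move=> gg' g'g Jg Jg'.
pose T (h : 'M[K]_n) c : chains := [ffun S => gl_act h (c S)].
have form h B s : gl_act h (linear_form B s) = linear_form (B *m h^T) s.
  rewrite /linear_form gl_act_sum.
  under eq_bigr => k _ do rewrite gl_actZ gl_actXU scaler_sumr.
  rewrite exchange_big; apply: eq_bigr => k _; rewrite mxE scaler_suml.
  by apply: eq_bigr => l _; rewrite scalerA mxE.
have hom h B : (forall f, J f -> J (gl_act h f)) -> koszul_hom B (B *m h^T) (T h).
  move=> Jh; split.
  - by move=> x y; apply/ffunP => S; rewrite !ffunE gl_actD.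
  - by move=> a x; apply/ffunP => S; rewrite !ffunE gl_actZ.
  - move=> i j c hc S; have := hc S; rewrite ffunE; case: ifP => _; last first.
      by move=> ->; rewrite gl_act0.
    exact: in_degree_gl_act.
  - by move=> c Jc S; rewrite ffunE; apply: Jh.
  move=> c; apply/ffunP => S; rewrite [RHS]ffunE !koszul_diffE gl_act_sum.
  apply: eq_bigr => s _; rewrite gl_actM form !ffunE; congr (_ * _).
  case: ifP => _; first by rewrite gl_act0.
  by rewrite gl_actM /koszul_sign /gl_act rmorphXn rmorphN1.
have TK h h' : h' *m h = 1%:M -> cancel (T h) (T h').
  by move=> hh' c; apply/ffunP => S; rewrite !ffunE gl_act_comp hh' gl_act1.
apply: (koszul_le_iso (T := T g) (T' := T g')); [exact: hom | | exact: TK | exact: TK].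
rewrite -[X in koszul_hom _ X _](_ : A *m g^T *m g'^T = A); first exact: hom.
by rewrite -mulmxA -trmx_mul g'g trmx1 mulmx1.
Qed.

End KoszulComplex.

(** * Invariance under invertible row operations *)

Section RowOperations.

Variables (n : nat) (K : fieldType) (J : {mpoly K[n]} -> Prop) (p : nat).
Hypothesis hJ : is_ideal J.

Local Notation chains := {ffun {set 'I_p} -> {mpoly K[n]}}.
Implicit Types (A : 'M[K]_(p, n)) (c : chains) (S : {set 'I_p}) (s t r : 'I_p).

Lemma linear_form_mul (E : 'M[K]_p) A r :
  linear_form (E *m A) r = \sum_s E r s *: linear_form A s.
Proof.
rewrite /linear_form; under [RHS]eq_bigr => s _ do rewrite scaler_sumr.
rewrite exchange_big; apply: eq_bigr => k _; rewrite mxE scaler_suml.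
by apply: eq_bigr => s _; rewrite scalerA.
Qed.

Lemma in_degree_sign (d : int) k (f : {mpoly K[n]}) :
  in_degree d f -> in_degree d ((-1) ^+ k * f).
Proof.
by move=> df m; rewrite -signr_odd; case: odd; rewrite ?expr1 ?mulN1r ?expr0 ?mul1r
  ?(perm_mem (msuppN f)); apply: df.
Qed.

Lemma in_degreeD (d : int) (f g : {mpoly K[n]}) :
  in_degree d f -> in_degree d g -> in_degree d (f + g).
Proof. by move=> df dg m /msuppD_le; rewrite mem_cat => /orP[/df|/dg]. Qed.

Lemma in_degreeZ (d : int) a (f : {mpoly K[n]}) : in_degree d f -> in_degree d (a *: f).
Proof. by move=> df m /msuppZ_le/df. Qed.

Lemma in_degree0 (d : int) : in_degree d (0 : {mpoly K[n]}).
Proof. by move=> m; rewrite msupp0. Qed.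

Section Transvection.

Variables (s t : 'I_p).
Hypothesis st : s != t.

(** [T a] is the automorphism of the exterior algebra with e_t sent to e_t + a e_s. The boundary of
    the image of e_t for A is row t of the transformed matrix, whence the chain map. *)
Let W c : chains := wedge s (contraction t c).
Let T (a : K) c : chains := c + a *: W c.

Let W_E c S : W c S = if (s \in S) && (t \notin S)
  then koszul_sign _ s S * koszul_sign _ t (S :\ s) * c (t |: (S :\ s)) else 0.
Proof.
rewrite /W !ffunE !inE [t == s]eq_sym st; case: (s \in S) => //=.
by case: (t \in S); rewrite /= ?mulr0 ?mulrA.
Qed.

Let contractionT r a c : contraction r (T a c) =
  T a (contraction r c) + (if r == s then a *: contraction t c else 0).
Proof.
have cD x y : contraction r (x + y) = contraction r x + contraction r y :> chains.
  apply/ffunP => S; rewrite [RHS]ffunE !ffunE.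
  by case: (r \in S); rewrite ?addr0 // mulrDr.
have cZ x : contraction r (a *: x) = a *: contraction r x :> chains.
  apply/ffunP => S; rewrite [RHS]ffunE !ffunE.
  by case: (r \in S); rewrite ?scaler0 // scalerAr.
have wN x : wedge s (- x) = - wedge s x :> chains.
  apply/ffunP => S; rewrite [RHS]ffunE !ffunE.
  by case: (s \in S); rewrite ?oppr0 // mulrN.
have anti : contraction r (contraction t c) = - contraction t (contraction r c).
  have [->|rt] := eqVneq r t; first by rewrite contraction_sqr oppr0.
  exact: contraction_anticomm.
rewrite /T cD cZ /W contraction_wedge anti wN opprK scalerDr -addrA; congr (_ + _).
by rewrite addrC; congr (_ + _); case: ifP; rewrite ?scaler0.
Qed.

Lemma koszul_hom_transvection a A :
  koszul_hom J ((1%:M + a *: delta_mx t s) *m A) A (T a).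
Proof.
have WD x y : W (x + y) = W x + W y.
  apply/ffunP => S; rewrite chainD [LHS]W_E [X in _ = X + _]W_E [X in _ = _ + X]W_E chainD.
  by case: ifP; rewrite ?addr0 // mulrDr.
have WZ b x : W (b *: x) = b *: W x.
  apply/ffunP => S; rewrite chainZ [LHS]W_E [X in _ = _ *: X]W_E chainZ.
  by case: ifP; rewrite ?scaler0 // scalerAr.
split.
- by move=> x y; rewrite /T WD scalerDr addrACA.
- by move=> b x; rewrite /T WZ scalerDr !scalerA [b * a]mulrC.
- move=> i j c hc S; rewrite /T chainD chainZ [X in _ *: X]W_E; have hS := hc S.
  case: (boolP (#|S| == i)) hS => [/eqP iS|iS] hS; last first.
    rewrite hS add0r; case: ifP => [/andP[sS tS]|_]; last by rewrite scaler0.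
    have := hc (t |: (S :\ s)).
    have -> : #|t |: (S :\ s)| = #|S|.
      by rewrite cardsU1 !inE (negPf tS) andbF /= [RHS](cardsD1 s) sS.
    by rewrite (negPf iS) => ->; rewrite mulr0 scaler0.
  apply: in_degreeD hS _; case: ifP => [/andP[sS tS]|_]; last by rewrite scaler0; apply: in_degree0.
  have := hc (t |: (S :\ s)).
  have -> : #|t |: (S :\ s)| = #|S|.
    by rewrite cardsU1 !inE (negPf tS) andbF /= [RHS](cardsD1 s) sS.
  rewrite iS eqxx => h; apply: in_degreeZ.
  by rewrite -mulrA; do 2!apply: in_degree_sign.
- move=> c Jc S; rewrite /T chainD chainZ W_E; apply: idealD => //; apply: idealZ => //.
  by case: ifP => _; [apply: idealM | apply: ideal0].
move=> c; apply/ffunP => S.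
have Wsum B S' : W (koszul_diff B c) S' = \sum_r linear_form B r * W (contraction r c) S'.
  rewrite [LHS]W_E; case: ifP => tS'; last first.
    by rewrite big1 // => r _; rewrite [X in _ * X]W_E tS' mulr0.
  rewrite koszul_diffE mulr_sumr; apply: eq_bigr => r _.
  by rewrite [in RHS]W_E tS' mulrCA.
rewrite koszul_diffE [in RHS]/T chainD chainZ Wsum koszul_diffE scaler_sumr -big_split /=.
have form r : linear_form ((1%:M + a *: delta_mx t s) *m A) r =
    linear_form A r + (if r == t then a *: linear_form A s else 0).
  rewrite mulmxDl mul1mx -scalemxAl.
  have lfD (X Y : 'M[K]_(p, n)) : linear_form (X + Y) r = linear_form X r + linear_form Y r.
    by rewrite /linear_form -big_split; apply: eq_bigr => k _; rewrite mxE scalerDl.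
  rewrite lfD; congr (_ + _).
  have lfZ (X : 'M[K]_(p, n)) : linear_form (a *: X) r = a *: linear_form X r.
    by rewrite /linear_form scaler_sumr; apply: eq_bigr => k _; rewrite mxE scalerA.
  rewrite lfZ linear_form_mul (bigD1 s) //= big1 ?addr0 => [|k ks]; last first.
    by rewrite mxE (negPf ks) andbF scale0r.
  by rewrite mxE eqxx andbT; case: ifP; rewrite ?scale1r // scale0r scaler0.
under [RHS]eq_bigr => r _ do rewrite scalerAr -mulrDr -chainZ -chainD -/(T a _) form mulrDl.
rewrite big_split /=.
under eq_bigr => r _ do rewrite contractionT chainD mulrDr.
rewrite big_split /=; congr (_ + _).
rewrite (bigD1 s) //= eqxx big1 ?addr0 => [|r rs]; last first.
  by rewrite (negPf rs) ffunE mulr0.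
rewrite [RHS](bigD1 t) //= eqxx [X in _ + X]big1 ?addr0 => [|r rt]; last first.
  by rewrite (negPf rt) mul0r.
(* The two leftover terms, r = s on the left and r = t on the right, agree because [contraction t]
   squares to zero. *)
have -> : T a (contraction t c) = contraction t c.
  rewrite /T /W contraction_sqr; have -> : wedge s 0 = 0 :> chains.
    by apply/ffunP => S'; rewrite !ffunE; case: ifP; rewrite ?mulr0.
  by rewrite scaler0 addr0.
by rewrite chainZ -scalerAr -scalerAl.
Qed.

Let TK a : cancel (T a) (T (- a)).
Proof.
have WT c : W (T a c) = W c.
  apply/ffunP => S; rewrite [LHS]W_E [RHS]W_E; case: ifP => // /andP[sS tS].
  by congr (_ * _); rewrite /T chainD chainZ [X in _ *: X]W_E !inE eqxx (negPf st) /= scaler0 addr0.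
by move=> c; rewrite {1}/T WT /T scaleNr addrK.
Qed.

Lemma koszul_le_transvection a A : koszul_le J A ((1%:M + a *: delta_mx t s) *m A).
Proof.
have h := koszul_hom_transvection a A.
have h' := koszul_hom_transvection (- a) ((1%:M + a *: delta_mx t s) *m A).
apply: (koszul_le_iso (T := T (- a)) (T' := T a) _ h).
- suff E : (1%:M + - a *: delta_mx t s) *m ((1%:M + a *: delta_mx t s) *m A) = A.
    by rewrite E in h'.
  rewrite mulmxA mulmxDl mul1mx mulmxDr mulmx1 -scalemxAl -scalemxAr.
  by rewrite mul_delta_mx_0 // !scaler0 addr0 scaleNr addrK mul1mx.
- by move=> c; rewrite -{2}[c](TK (- a)) opprK.
- exact: TK.
Qed.

End Transvection.

(** Row scaling is written in the shape 1 + b E of a transvection, so that [transvection_mulE]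
    computes entries in both cases. *)
Lemma scaling_mulV s (a : K) : a != 0 ->
  (1%:M + (a^-1 - 1) *: delta_mx s s) *m (1%:M + (a - 1) *: delta_mx s s) = 1%:M :> 'M[K]_p.
Proof.
move=> a0; rewrite mulmxDl mul1mx mulmxDr mulmx1 -scalemxAl -scalemxAr mul_delta_mx.
rewrite scalerA -addrA -!scalerDl.
have -> : a - 1 + (a^-1 - 1 + (a^-1 - 1) * (a - 1)) = 0 by field.
by rewrite scale0r addr0.
Qed.

Lemma koszul_le_scaling s (a : K) A : a != 0 ->
  koszul_le J A ((1%:M + (a - 1) *: delta_mx s s) *m A).
Proof.
pose D (b : K) c : chains := [ffun S : {set 'I_p} => (if s \in S then b else 1) *: c S].
have D_E b c S : D b c S = (if s \in S then b else 1) *: c S by rewrite ffunE.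
have DK b b' : b * b' = 1 -> cancel (D b) (D b').
  move=> bb' c; apply/ffunP => S; rewrite !D_E scalerA; case: ifP; rewrite ?mulr1 ?scale1r //.
  by rewrite mulrC bb' scale1r.
have form b (B : 'M[K]_(p, n)) r : linear_form ((1%:M + (b - 1) *: delta_mx s s) *m B) r =
    (if r == s then b else 1) *: linear_form B r.
  rewrite linear_form_mul (bigD1 r) //= big1 ?addr0 => [|k kr]; last first.
    rewrite !mxE [r == k]eq_sym (negPf kr) add0r; case: eqP => [rs|_].
      by rewrite -rs (negPf kr) mulr0 scale0r.
    by rewrite mulr0 scale0r.
  rewrite !mxE eqxx; case: eqP => _ /=; last by rewrite mulr0 addr0.
  by rewrite mulr1 addrC subrK.
have hom b (B : 'M[K]_(p, n)) : koszul_hom J ((1%:M + (b - 1) *: delta_mx s s) *m B) B (D b).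
  split.
  - by move=> x y; apply/ffunP => S; rewrite chainD !D_E chainD scalerDr.
  - by move=> e x; apply/ffunP => S; rewrite chainZ !D_E chainZ !scalerA mulrC.
  - move=> i j c hc S; rewrite D_E; have := hc S; case: ifP => _.
      exact: in_degreeZ.
    by move=> ->; rewrite scaler0.
  - by move=> c Jc S; rewrite D_E; apply: idealZ.
  move=> c; apply/ffunP => S; rewrite D_E !koszul_diffE scaler_sumr.
  apply: eq_bigr => r _; rewrite form !ffunE; case: ifP => rS; first by rewrite !mulr0 scaler0.
  rewrite !inE -!scalerAr -!scalerAl scalerA; congr (_ *: _).
  by rewrite eq_sym; case: eqP rS => [->->|_ _] /=; rewrite ?mul1r ?mulr1.
move=> a0; have h := hom a A.
have h' := hom a^-1 ((1%:M + (a - 1) *: delta_mx s s) *m A).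
apply: (koszul_le_iso (T := D a^-1) (T' := D a) _ h); last 2 first.
- by apply: DK; rewrite mulVf.
- by apply: DK; rewrite mulfV.
suff E : (1%:M + (a^-1 - 1) *: delta_mx s s) *m ((1%:M + (a - 1) *: delta_mx s s) *m A) = A.
  by rewrite E in h'.
by rewrite mulmxA scaling_mulV ?mul1mx.
Qed.

Definition row_operation (E : 'M[K]_p) : Prop := forall A, koszul_le J A (E *m A).

Lemma row_operation_step (E B : 'M[K]_p) (E' : 'M[K]_p) :
  row_operation E' -> E' *m E = 1%:M -> row_operation (E *m B) -> row_operation B.
Proof.
move=> hE' EE hEB A; have := koszul_le_trans (hEB A) (hE' _).
by rewrite mulmxA mulmxA EE mul1mx.
Qed.

Lemma row_operation_transvection (B : 'M[K]_p) s t (a : K) : s != t ->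
  row_operation ((1%:M + a *: delta_mx s t) *m B) -> row_operation B.
Proof.
move=> st; apply: (row_operation_step (E' := 1%:M + - a *: delta_mx s t)).
  by move=> A; apply: koszul_le_transvection; rewrite eq_sym.
rewrite mulmxDl mul1mx mulmxDr mulmx1 -scalemxAl -scalemxAr.
by rewrite mul_delta_mx_0 1?eq_sym // !scaler0 addr0 scaleNr addrK.
Qed.

Lemma row_operation_scaling (B : 'M[K]_p) s (a : K) : a != 0 ->
  row_operation ((1%:M + (a - 1) *: delta_mx s s) *m B) -> row_operation B.
Proof.
move=> a0; apply: (row_operation_step (E' := 1%:M + (a^-1 - 1) *: delta_mx s s)).
  by move=> A; apply: koszul_le_scaling; rewrite invr_eq0.
exact: scaling_mulV.
Qed.

Lemma transvection_mulE (B : 'M[K]_p) s t (a : K) r k :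
  ((1%:M + a *: delta_mx s t) *m B) r k = B r k + (if r == s then a * B t k else 0).
Proof.
rewrite mulmxDl mul1mx -scalemxAl !mxE; congr (_ + _).
rewrite (bigD1 t) //= big1 ?addr0 => [|l lt]; last by rewrite mxE (negPf lt) andbF mul0r.
by rewrite mxE eqxx andbT; case: ifP; rewrite ?mul1r // mul0r mulr0.
Qed.

Lemma unitmx_transvection (B : 'M[K]_p) s t (a : K) : s != t ->
  B \in unitmx -> (1%:M + a *: delta_mx s t) *m B \in unitmx.
Proof.
move=> st Bu; rewrite unitmx_mul Bu andbT.
suff /mulmx1_unit[] : (1%:M + a *: delta_mx s t) *m (1%:M + - a *: delta_mx s t) = 1%:M by [].
rewrite mulmxDl mul1mx mulmxDr mulmx1 -scalemxAl -scalemxAr.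
by rewrite mul_delta_mx_0 1?eq_sym // !scaler0 addr0 scaleNr subrK.
Qed.

Lemma unitmx_scaling (B : 'M[K]_p) s (a : K) : a != 0 ->
  B \in unitmx -> (1%:M + (a - 1) *: delta_mx s s) *m B \in unitmx.
Proof.
move=> a0 Bu; rewrite unitmx_mul Bu andbT.
suff /mulmx1_unit[] : (1%:M + (a - 1) *: delta_mx s s) *m
    (1%:M + (a^-1 - 1) *: delta_mx s s) = 1%:M by [].
by rewrite -{1}[a]invrK scaling_mulV ?invr_eq0.
Qed.

(** Gaussian elimination: elementary matrices avoid describing the action of a general matrix on the
    exterior algebra by minors. Here [k] counts the columns not yet reduced, and [q] is the next
    one. *)
Lemma unitmx_row_operation (B : 'M[K]_p) : B \in unitmx -> row_operation B.
Proof.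
suff h k : (k <= p)%N -> forall B : 'M[K]_p, B \in unitmx ->
    (forall r s, (s < p - k)%N -> B r s = (r == s)%:R) -> row_operation B.
  by move=> Bu; apply: (h p) => // r s; rewrite subnn.
elim: k => [_ {}B _ B1 A|k IHk lt_kp {}B].
  suff -> : B = 1%:M by rewrite mul1mx.
  by apply/matrixP => r s; rewrite B1 ?mxE // subn0.
have lt_pk : (p - k.+1 < p)%N by rewrite ltn_subrL (leq_ltn_trans _ lt_kp).
pose q := Ordinal lt_pk.
have ltq (s : 'I_p) : (s < p - k)%N = (s < q)%N || (s == q).
  by rewrite -val_eqE /= -subSS subSn // ltnS leq_eqVlt orbC.
(* Once the pivot is 1, [m] bounds the number of nonzero entries left to clear in column [q]. *)
suff clear m : forall C : 'M[K]_p, C \in unitmx -> C q q = 1 ->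
    (forall r s, (s < q)%N -> C r s = (r == s)%:R) ->
    (#|[pred r | (r != q) && (C r q != 0%R)]| <= m)%N -> row_operation C.
  have scale (C : 'M[K]_p) : C \in unitmx -> C q q != 0 ->
      (forall r s, (s < q)%N -> C r s = (r == s)%:R) -> row_operation C.
    move=> Cu Cq C1; apply: (@row_operation_scaling _ q (C q q)^-1); first by rewrite invr_eq0.
    apply: (clear _ _ _ _ _ (leqnn _)).
    - by apply: unitmx_scaling; rewrite ?invr_eq0.
    - by rewrite transvection_mulE eqxx mulrBl mul1r mulVf // addrC subrK.
    move=> r s sq; rewrite transvection_mulE; case: eqP => [->|_]; last by rewrite addr0 C1.
    have qs : (q == s) = false by rewrite -val_eqE /= gtn_eqF.
    by rewrite (C1 q s sq) qs mulr0 addr0.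
  move=> Bu B1; have [Bq|Bq] := eqVneq (B q q) 0; last exact: scale.
  have [r [qr Br]] : exists r : 'I_p, (q < r)%N /\ B r q != 0.
    apply: NNPP => nr.
    (* Without a pivot, column [q] would be a combination of the earlier columns, which are unit
       vectors; [v] is the resulting kernel vector. *)
    pose v : 'cV[K]_p := \col_r (if (r < q)%N then - B r q else (r == q)%:R).
    have Bv : B *m v = 0.
      apply/matrixP => r z; rewrite !mxE (bigD1 q) //= mxE ltnn eqxx mulr1.
      have Brq : B r q = if (r < q)%N then B r q else 0.
        case: ltngtP => // [qr|rq]; last by have -> : r = q by apply: val_inj.
        by apply/eqP/negPn/negP => Br; apply: nr; exists r.
      rewrite (bigID (fun s : 'I_p => s < q)%N) /= [X in _ + (_ + X)]big1 ?addr0; last first.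
        by move=> s /andP[sq nsq]; rewrite mxE (negPf nsq) (negPf sq) mulr0.
      rewrite Brq; case: ifP => rq; last first.
        rewrite add0r big1 // => s /andP[sq ltsq]; rewrite mxE ltsq (B1 r s ltsq).
        by case: eqP rq => [->|_]; rewrite ?ltsq // mul0r.
      rewrite (bigD1 r) /=; last by rewrite rq andbT -val_eqE /= ltn_eqF.
      rewrite mxE rq (B1 r r rq) eqxx mul1r big1 ?addr0 ?subrr //.
      by move=> s /andP[/andP[_ ltsq] sr]; rewrite (B1 r s ltsq) eq_sym (negPf sr) mul0r.
    have : v = 0 by rewrite -(mulKmx Bu v) Bv mulmx0.
    by move/matrixP/(_ q 0); rewrite !mxE ltnn eqxx => /eqP; rewrite oner_eq0.
  have nqr : q != r by rewrite -val_eqE /= ltn_eqF.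
  apply: (@row_operation_transvection _ q r 1) => //; apply: scale.
  - exact: unitmx_transvection.
  - by rewrite transvection_mulE eqxx mul1r Bq add0r.
  move=> r' s sq; rewrite transvection_mulE; case: eqP => [->|_]; last by rewrite addr0 B1.
  have rs : (r == s) = false by rewrite -val_eqE /= gtn_eqF // (ltn_trans sq).
  by rewrite mul1r !B1 // rs addr0.
elim: m => [|m IHm] C Cu Cq C1 Cm.
  apply: IHk => //; first exact: ltnW.
  move=> r s; rewrite ltq => /orP[/C1//|/eqP->].
  have [->|rq] := eqVneq r q; first by rewrite Cq.
  move: Cm; rewrite leqn0 => /eqP/card0_eq/(_ r).
  by rewrite inE rq /= => /negbFE/eqP.
have [[r [rq Cr]]|nr] := classic (exists r, r != q /\ C r q != 0); last first.
  apply: IHm => //; rewrite eq_card0 // => r; rewrite inE.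
  by apply/negbTE/negP => /andP[rq Cr]; apply: nr; exists r.
apply: (@row_operation_transvection _ r q (- C r q)) => //; apply: IHm.
- exact: unitmx_transvection.
- by rewrite transvection_mulE eq_sym (negPf rq) addr0.
- move=> r' s sq; rewrite transvection_mulE; case: eqP => [->|_]; last by rewrite addr0 C1.
  have qs : (q == s) = false by rewrite -val_eqE /= gtn_eqF.
  by rewrite (C1 r s sq) (C1 q s sq) qs mulr0 addr0.
rewrite -ltnS; apply: leq_trans Cm; apply: proper_card; apply/properP; split.
  apply/subsetP => r'; rewrite !inE transvection_mulE => /andP[-> ].
  by case: (r' =P r) => [->|_]; rewrite ?addr0 //= Cq mulr1 subrr eqxx.
exists r; rewrite !inE rq //= transvection_mulE eqxx Cq mulr1 subrr eqxx //.
Qed.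

End RowOperations.

(** * Koszul homology with respect to the last variables *)

Lemma mcoeff_sign n (R : nzRingType) k (f : {mpoly R[n]}) m :
  ((-1) ^+ k * f)@_m = (-1) ^+ k * f@_m.
Proof.
rewrite -(signr_odd _ k) -[in RHS]signr_odd; case: odd; first by rewrite !expr1 !mulN1r mcoeffN.
by rewrite !expr0 !mul1r.
Qed.

Lemma mcoeffXM n (R : nzRingType) k (f : {mpoly R[n]}) m :
  ('X_k * f)@_m = if (0 < m k)%N then f@_(m - U_(k))%MM else 0.
Proof.
rewrite -commr_mpolyX; case: posnP => mk; last first.
  by rewrite -[in LHS](@submK _ U_(k)%MM m) 1?addmC ?mcoeffMX // lep1mP -lt0n.
apply/memN_msupp_eq0/negP => /msuppM_le/allpairsP[[a b] /= [_]].
by rewrite msuppX inE => /eqP-> mab; move: mk; rewrite mab mnmDE mnm1E eqxx addn1.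
Qed.

Section LastVariables.

Variables (n p : nat) (hp : (p <= n)%N) (K : fieldType) (E : pred 'X_{1..n}).
Hypothesis Eup : up_closed E.
Hypothesis Ess : strongly_stable E.

Local Notation chains := {ffun {set 'I_p} -> {mpoly K[n]}}.
Implicit Types (c z w : chains) (S : {set 'I_p}) (s t : 'I_p) (m u : 'X_{1..n}).

Definition last_variable s : 'I_n := cast_ord (subnK hp) (rshift (n - p) s).
Local Notation nu := last_variable.

Lemma val_last_variable s : nu s = (n - p + s)%N :> nat. Proof. by []. Qed.

Lemma last_variable_inj : injective nu.
Proof. by move=> s t /cast_ord_inj/rshift_inj. Qed.

Definition last_forms : 'M[K]_(p, n) := \matrix_(s, k) (k == nu s)%:R.

Lemma linear_form_last s : linear_form last_forms s = 'X_(nu s).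
Proof.
rewrite /linear_form (bigD1 (nu s)) //= mxE eqxx scale1r big1 ?addr0 // => k ks.
by rewrite mxE (negPf ks) scale0r.
Qed.

Lemma mcoeff_koszul_diff c S m :
  (koszul_diff last_forms c S)@_m =
    \sum_(s | s \notin S) (-1) ^+ #|[set t in S | (t < s)%N]| *
      (if (0 < m (nu s))%N then (c (s |: S))@_(m - U_(nu s))%MM else 0).
Proof.
rewrite ffunE raddf_sum; apply: eq_bigr => s _ /=.
by rewrite -mulrA mcoeff_sign linear_form_last mcoeffXM.
Qed.

Lemma koszul_chain_diff i j c :
  koszul_chain i.+1 j c -> koszul_chain i j (koszul_diff last_forms c).
Proof.
move=> hc S; have hc' s (sS : s \notin S) := hc (s |: S).
case: ifP => iS; last first.
  rewrite ffunE big1 // => s sS; have := hc (s |: S).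
  by rewrite cardsU1 sS add1n eqSS iS => ->; rewrite mulr0.
move=> m; rewrite mcoeff_msupp mcoeff_koszul_diff => nz.
have [s /andP[sS nzs]] : exists s, (s \notin S) &&
    ((if (0 < m (nu s))%N then (c (s |: S))@_(m - U_(nu s))%MM else 0) != 0).
  apply: NNPP => ns; case/eqP: nz; apply: big1 => s sS.
  rewrite [X in _ * X](_ : _ = 0) ?mulr0 //; apply/eqP/negPn/negP => h.
  by apply: ns; exists s; rewrite sS.
move: nzs; case: posnP => [_|ms]; first by rewrite eqxx.
rewrite -mcoeff_msupp; have := hc (s |: S); rewrite cardsU1 sS add1n eqSS iS => h /h.
rewrite -[in mdeg m](@submK _ U_(nu s)%MM m) ?lep1mP -?lt0n // mdegD mdeg1.
by rewrite PoszD => ->; rewrite -addn1 PoszD opprD addrA subrK.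
Qed.

(* When x_t is the largest of the last variables dividing x^m and t is above
   S, the chain x^m e_S is, up to sign, the movable part of the boundary of
   (x^m / x_t) e_{S + t}; these pairs cancel in homology. *)
Definition movable m S : bool :=
  [exists t, (0 < m (nu t))%N && [forall s in S, (s < t)%N]].

Definition critical m S : bool :=
  [&& ~~ movable m S, ~~ E m & [forall s in S, E (m + U_(nu s))%MM]].

Lemma movableP m S :
  reflect (exists t, (0 < m (nu t))%N /\ forall s, s \in S -> (s < t)%N) (movable m S).
Proof.
apply: (iffP existsP) => [[t /andP[mt /forall_inP tS]]|[t [mt tS]]]; exists t => //.
by rewrite mt; apply/forall_inP.
Qed.

Definition divide_variable k (P : pred 'X_{1..n}) (f : {mpoly K[n]}) : {mpoly K[n]} :=
  \sum_(u <- msupp f | (0 < u k)%N && P (u - U_(k))%MM) f@_u *: 'X_[u - U_(k)].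

Lemma mcoeff_divide_variable k P f m :
  (divide_variable k P f)@_m = if P m then f@_(m + U_(k))%MM else 0.
Proof.
rewrite raddf_sum /=.
have eq_u u : (0 < u k)%N -> ((u - U_(k))%MM == m) = (u == (m + U_(k))%MM).
  move=> uk; rewrite -(eqm_add2r U_(k)%MM) submK // lep1mP -?lt0n //.
rewrite (eq_bigr (fun u => f@_u * (u == (m + U_(k))%MM)%:R)); last first.
  by move=> u /andP[uk _]; rewrite mcoeffZ mcoeffX eq_u.
have mk : (0 < (m + U_(k))%MM k)%N by rewrite mnmDE mnm1E eqxx addn1.
have mkK : ((m + U_(k)) - U_(k) = m)%MM by rewrite addmK.
have [mf|nmf] := boolP ((m + U_(k))%MM \in msupp f); last first.
  rewrite (memN_msupp_eq0 nmf) if_same big_seq_cond big1 // => u /andP[uf _].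
  by case: eqP => [um|_]; rewrite ?mulr0 //; rewrite um (negPf nmf) in uf.
rewrite big_mkcond (bigD1_seq _ mf) ?msupp_uniq //= mk mkK eqxx mulr1 big1 ?addr0 // => u um.
by case: ifP => // _; rewrite (negPf um) mulr0.
Qed.

(** Along each pair the boundary is inverted: at a non-movable (m, S) with t = max S, [w] takes up
    to sign the coefficient of z at (m y_t, S - t). The construction takes place over R, so J does
    not enter. *)
Lemma movable_part z : exists w : chains,
  (forall i j, koszul_chain i j z -> koszul_chain i.+1 j w) /\
  forall m S, movable m S -> (koszul_diff last_forms w S)@_m = (z S)@_m.
Proof.
pose top t S := (t \in S) && [forall s in S, (s <= t)%N].
pose w : chains := [ffun S : {set 'I_p} => \sum_(t | top t S)
  (-1) ^+ #|[set s in S :\ t | (s < t)%N]| *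
    divide_variable (nu t) (fun m => ~~ movable m S) (z (S :\ t))].
have wE S m : (w S)@_m = \sum_(t | top t S) (-1) ^+ #|[set s in S :\ t | (s < t)%N]| *
    (if ~~ movable m S then (z (S :\ t))@_(m + U_(nu t))%MM else 0).
  rewrite ffunE raddf_sum; apply: eq_bigr => t _ /=.
  by rewrite mcoeff_sign mcoeff_divide_variable.
exists w; split=> [i j hz S|m S].
  have card_top t : top t S -> #|S| = #|S :\ t|.+1 by case/andP=> tS _; rewrite (cardsD1 t) tS.
  case: ifP => iS; last first.
    rewrite ffunE big1 // => t tS; have := hz (S :\ t).
    rewrite (card_top _ tS) eqSS in iS; rewrite iS => ->.
    by rewrite /divide_variable big_seq_cond msupp0 big_pred0 ?mulr0.
  move=> m; rewrite mcoeff_msupp wE => nz.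
  have [t [tS zt]] : exists t, top t S /\ (z (S :\ t))@_(m + U_(nu t))%MM != 0.
    apply: NNPP => nt; case/eqP: nz; apply: big1 => t tS.
    rewrite [X in _ * X](_ : _ = 0) ?mulr0 //; case: ifP => // _.
    by apply/eqP/negPn/negP => h; apply: nt; exists t.
  have := hz (S :\ t); rewrite (card_top _ tS) eqSS in iS; rewrite iS => /(_ (m + U_(nu t))%MM).
  rewrite mcoeff_msupp => /(_ zt); rewrite mdegD mdeg1 PoszD => h.
  by rewrite -addn1 PoszD opprD addrA -h addrK.
case/movableP=> t1 [mt1 t1S].
case: (@arg_maxnP _ t1 (fun t => (0 < m (nu t))%N) val mt1) => t mt tmax'.
have tmax r : (0 < m (nu r))%N -> (r <= t)%N by move/tmax'.
have tS s : s \in S -> (s < t)%N by move=> sS; apply: leq_trans (t1S s sS) (tmax _ mt1).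
have ntS : t \notin S by apply/negP => /tS; rewrite ltnn.
(* For s other than t, y_t still divides m / y_s and t exceeds S + s, so that cell is movable and
   [w] vanishes there. *)
rewrite mcoeff_koszul_diff (bigD1 t) //= mt big1 ?addr0 => [|s /andP[sS st]]; last first.
  case: posnP => [_|ms]; first by rewrite mulr0.
  have lt_st : (s < t)%N by rewrite ltn_neqAle val_eqE st tmax ?ms.
  rewrite wE big1 ?mulr0 // => r _; rewrite (_ : movable _ _ = true) ?mulr0 //.
  apply/movableP; exists t; split=> [|r'].
    rewrite mnmBE mnm1E (negPf _ : (nu s == nu t) = false) ?subn0 //.
    by apply: contra st => /eqP/last_variable_inj->.
  by rewrite !inE => /predU1P[->//|/tS].
rewrite wE (bigD1 t) /=; last first.
  rewrite /top !inE eqxx /=; apply/forall_inP => s.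
  by rewrite !inE => /predU1P[->//|/tS/ltnW].
rewrite big1 ?addr0 => [|r /andP[/andP[rS /forall_inP/(_ t)]]]; last first.
  rewrite !inE eqxx => /(_ isT) tr /eqP nrt; case: nrt; apply: val_inj.
  move: rS; rewrite !inE => /predU1P[->//|/tS].
  by rewrite ltnNge tr.
rewrite ifT; last first.
  apply/negP => /movableP[r [mr /(_ t)]]; rewrite !inE eqxx => /(_ isT) tr.
  have : (0 < m (nu r))%N by apply: leq_trans mr _; rewrite mnmBE leq_subr.
  by move/tmax; rewrite leqNgt tr.
rewrite setU1K // submK ?lep1mP -?lt0n // mulrA -exprD addnn -signr_odd odd_double mul1r //.
Qed.

(** With t = max S, the coefficient of the boundary at the movable cell (m y_t, S - t) reduces to
    that of z at (m, S), the other terms being on movable cells. So m y_t lies in E, and strong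
    stability gives m y_s for the smaller s. *)
Lemma critical_support z :
    (forall m S, movable m S -> (z S)@_m = 0) ->
    (forall m S, movable m S -> ~~ E m -> (koszul_diff last_forms z S)@_m = 0) ->
  forall m S, ~~ E m -> (z S)@_m != 0 -> critical m S.
Proof.
move=> zV dzV m S nEm zm.
have nmov : ~~ movable m S by apply: contra zm => /zV/eqP.
rewrite /critical nmov nEm /=; apply/forall_inP => s0 s0S.
case: (@arg_maxnP _ s0 (fun s => s \in S) val s0S) => t tS tmax'.
have tmax r : r \in S -> (r <= t)%N by move/tmax'.
suff Emt : E (m + U_(nu t))%MM.
  have := tmax _ s0S; rewrite /= leq_eqVlt => /orP[/eqP/val_inj->//|lt_s0t].
  by apply: (Ess _ Emt); rewrite !val_last_variable ltn_add2l.
apply/negPn/negP => nEmt.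
have mov : movable (m + U_(nu t))%MM (S :\ t).
  apply/movableP; exists t; split; first by rewrite mnmDE mnm1E eqxx addn1.
  by move=> s; rewrite !inE => /andP[st /tmax]; rewrite ltn_neqAle st.
case/eqP: zm; have := dzV _ _ mov nEmt; rewrite mcoeff_koszul_diff (bigD1 t) ?inE ?eqxx //=.
rewrite mnmDE mnm1E eqxx addn1 /= big1 ?addr0 => [|s /andP[]].
  by rewrite setD1K // addmK => /eqP; rewrite mulf_eq0 signr_eq0 /= => /eqP.
rewrite !inE => sS st; rewrite st /= in sS.
rewrite mnmDE mnm1E (negPf _ : (nu t == nu s) = false) ?addn0; last first.
  by apply: contra st => /eqP/last_variable_inj->.
case: posnP => [_|ms]; first by rewrite mulr0.
have lt_st : (s < t)%N.
  rewrite ltn_neqAle st leqNgt; apply/negP => ts; case/negP: nmov; apply/movableP.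
  by exists s; split=> // r /tmax rt; apply: leq_ltn_trans rt ts.
rewrite zV ?mulr0 //; apply/movableP; exists t; split.
  rewrite mnmBE mnmDE !mnm1E eqxx (negPf _ : (nu s == nu t) = false) ?subn0 ?addn1 //.
  by apply: contra st => /eqP/last_variable_inj->.
by move=> r; rewrite !inE => /predU1P[->//|/andP[rt /tmax]]; rewrite ltn_neqAle rt.
Qed.

(** The differential vanishes modulo J on critical chains: a contribution at m from (m / y_s, S + s)
    would put m in E by criticality. *)
Lemma critical_cycle z :
    (forall m S, ~~ E m -> (z S)@_m != 0 -> critical m S) ->
  forall S, monomial_ideal E (koszul_diff last_forms z S).
Proof.
move=> zc S m; rewrite mcoeff_msupp; apply: contraNT => nEm.
rewrite mcoeff_koszul_diff big1 // => s sS.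
case: posnP => [_|ms]; first by rewrite mulr0.
have msK : ((m - U_(nu s)) + U_(nu s) = m)%MM by rewrite submK // lep1mP -lt0n.
have nEms : ~~ E (m - U_(nu s))%MM.
  by apply: contra nEm => Ems; rewrite -msK addmC; apply: Eup.
apply/eqP; rewrite mulf_eq0 signr_eq0 /=; apply/negPn/negP => zs.
have /and3P[_ _ /forall_inP/(_ s)] := zc _ _ nEms zs.
by rewrite !inE eqxx msK => /(_ isT); apply/negP.
Qed.

Definition critical_cells d i : {pred 'X_{1..n < d.+1} * {set 'I_p}} :=
  [pred x : 'X_{1..n < d.+1} * {set 'I_p} |
    [&& mdeg (val x.1) == d, #|x.2| == i & critical (val x.1) x.2]].

Lemma monomial_ideal_ideal : is_ideal (monomial_ideal (K := K) E).
Proof.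
split; first by move=> m; rewrite msupp0.
  by move=> f g Ef Eg m /msuppD_le; rewrite mem_cat => /orP[/Ef|/Eg].
by move=> f g Eg m /msuppM_le/allpairsP[[a b] /= [_ /Eg Eb ->]]; apply: Eup.
Qed.

Theorem koszul_homology_last i (j : int) d : j - i%:Z = d%:Z ->
  has_quotient_dim (koszul_cycle (monomial_ideal (K := K) E) last_forms i j)
    (koszul_boundary (monomial_ideal (K := K) E) last_forms i j) #|@critical_cells d i|.
Proof.
move=> jid; set J := monomial_ideal E.
pose T := {x : 'X_{1..n < d.+1} * {set 'I_p} | x \in @critical_cells d i}.
have -> : #|@critical_cells d i| = #|{: T}| by rewrite card_sig; apply: eq_card.
have nEJ f m : J f -> ~~ E m -> f@_m = 0.
  by move=> Jf nEm; apply/memN_msupp_eq0; apply: contra nEm => /Jf.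
pose v (x : T) : chains :=
  [ffun S => if S == (val x).2 then 'X_[(val (val x).1 : 'X_{1..n})] else 0].
have vE (a : T -> K) S m : ((\sum_x a x *: v x) S)@_m =
    \sum_(x : T) a x * ((S == (val x).2) && (val (val x).1 == m))%:R.
  rewrite sum_ffunE raddf_sum; apply: eq_bigr => x _; rewrite /= chainZ mcoeffZ ffunE.
  by case: eqP => _; rewrite ?mcoeff0 ?mcoeffX.
have vin (a : T -> K) (x : T) : ((\sum_y a y *: v y) (val x).2)@_(val (val x).1) = a x.
  rewrite vE (bigD1 x) //= !eqxx mulr1 big1 ?addr0 // => y yx.
  case: eqP => [e2|]; last by rewrite mulr0.
  case: eqP => [e1|]; last by rewrite mulr0.
  by case/eqP: yx; apply: val_inj; apply: injective_projections => //; apply: val_inj.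
have vout (a : T -> K) S m : ~~ critical m S -> ((\sum_y a y *: v y) S)@_m = 0.
  move=> nc; rewrite vE big1 // => x _; case: eqP => [e2|]; last by rewrite mulr0.
  case: eqP => [e1|]; last by rewrite mulr0.
  by move: nc; rewrite -e1 e2; have /and3P[_ _ ->] := valP x.
have vch x : koszul_chain i j (v x).
  move=> S; rewrite ffunE; have /and3P[/eqP dx /eqP ix _] := valP x.
  case: (S =P _) => [->|_]; last by case: ifP => // _ m; rewrite msupp0.
  by rewrite ix eqxx => m; rewrite msuppX inE => /eqP->; rewrite dx jid.
have vsumch (a : T -> K) : koszul_chain i j (\sum_x a x *: v x).
  elim/big_ind: _ => [|x y|x _]; [exact: koszul_chain0 | exact: koszul_chainD |].
  exact/koszul_chainZ/vch.
have diffB w c S : (koszul_diff last_forms (c - koszul_diff last_forms w) S) =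
    koszul_diff last_forms c S.
  by rewrite koszul_diffB koszul_diff_sqr subr0.
apply: (has_quotient_dim_fin (v := v)).
- move=> x; split; first exact: vch.
  apply: critical_cycle => m S nEm; rewrite ffunE; case: (S =P _) => [->|_]; last first.
    by rewrite mcoeff0 eqxx.
  rewrite mcoeffX; case: (_ =P m) => [<- _|_]; last by rewrite eqxx.
  by have /and3P[] := valP x.
- move=> a [_ [b hb Jb]] x.
  (* Independence: correct [b] by a boundary so that it has no movable part. It is then critical
     outside J, since its boundary is modulo J a combination of critical cells, so this combination
     lies in J. *)
  have [w [_ hw]] := movable_part b.
  pose b' := b - koszul_diff last_forms w.
  have b'V m S : movable m S -> (b' S)@_m = 0.
    by move=> mov; rewrite /b' chainB mcoeffB hw // subrr.
  have db'V m S : movable m S -> ~~ E m -> (koszul_diff last_forms b' S)@_m = 0.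
    move=> mov nEm; rewrite diffB; have := nEJ _ _ (Jb S) nEm.
    by rewrite mcoeffB vout ?sub0r /critical ?mov // => /eqP; rewrite oppr_eq0 => /eqP.
  have Jdb : J (koszul_diff last_forms b' (val x).2).
    exact: critical_cycle (critical_support b'V db'V) _.
  rewrite diffB in Jdb; have /and3P[_ _ /and3P[_ nEx _]] := valP x.
  have := nEJ _ _ (Jb (val x).2) nEx; rewrite mcoeffB vin.
  by rewrite (nEJ _ _ Jdb nEx) subr0.
(* Spanning: subtracting a boundary removes the movable part of the cycle, and what remains outside
   J is critical. *)
move=> z [hz Jz]; have [w [hw wV]] := movable_part z.
pose z' := z - koszul_diff last_forms w.
have z'V m S : movable m S -> (z' S)@_m = 0.
  by move=> mov; rewrite /z' chainB mcoeffB wV // subrr.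
have dz'V m S : movable m S -> ~~ E m -> (koszul_diff last_forms z' S)@_m = 0.
  by move=> mov nEm; rewrite diffB; apply: nEJ.
have z'c := critical_support z'V dz'V.
have hz' : koszul_chain i j z'.
  by apply: koszul_chainB => //; apply: koszul_chain_diff; apply: hw.
exists (fun x => (z' (val x).2)@_(val (val x).1)); split; first exact: koszul_chainB.
exists w; first exact: hw.
move=> S m; rewrite mcoeff_msupp; apply: contraNT => nEm.
rewrite chainB addrAC -(chainB z) mcoeffB -/z'.
have [zm|zm] := eqVneq (z' S)@_m 0.
  rewrite zm sub0r oppr_eq0 vE big1 // => x _.
  case: eqP => [e2|]; last by rewrite mulr0.
  by case: eqP => [e1|]; rewrite ?mulr0 // -e2 e1 zm mul0r.
have cm := z'c _ _ nEm zm.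
have [iS dm] : #|S| = i /\ mdeg m = d.
  have := hz' S; case: eqP => [iS h|_ z0]; last by rewrite z0 mcoeff0 eqxx in zm.
  by split=> //; rewrite -mcoeff_msupp in zm; have := h m zm; rewrite jid => -[].
have lt_md : (mdeg m < d.+1)%N by rewrite dm.
have xP : (BMultinom lt_md, S) \in @critical_cells d i by rewrite inE /= dm iS !eqxx cm.
by have := vin (fun x => (z' (val x).2)@_(val (val x).1)) (Sub (BMultinom lt_md, S) xP) => /= ->;
  rewrite subrr.
Qed.

Lemma koszul_homology_negative (J : {mpoly K[n]} -> Prop) (A : 'M[K]_(p, n)) i (j : int) d :
    is_ideal J -> j - i%:Z = Negz d ->
  has_quotient_dim (koszul_cycle J A i j) (koszul_boundary J A i j) 0.
Proof.
move=> hJ jid; exists (fun=> 0); split=> [[]//|a _ []//|z [hz _]].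
exists (fun=> 0); rewrite big_ord0 subr0.
suff -> : z = 0 by have [] := koszul_boundary_subspace hJ A i j.
apply/ffunP => S; rewrite ffunE; have := hz S; case: ifP => // _; rewrite jid => dz.
apply: msuppnil0; case fE: (msupp (z S)) => [//|m s].
by have := dz m; rewrite fE mem_head => /(_ isT).
Qed.

End LastVariables.

(** Each variable goes to a combination of itself and earlier variables, and strong stability
    permits these exchanges one at a time. *)
Lemma monomial_ideal_triangular n (K : fieldType) (E : pred 'X_{1..n}) (g : 'M[K]_n) f :
    up_closed E -> strongly_stable E -> (forall k l, g k l != 0 -> (k <= l)%N) ->
  monomial_ideal E f -> monomial_ideal E (gl_act g f).
Proof.
move=> Eup Ess gle; have hE := monomial_ideal_ideal K Eup.
(* The cofactor [u] carries the variables set aside during the induction on the degree of [m], so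
   that the full monomial stays in E. *)
have mono d : forall m u, mdeg m = d -> E (m + u)%MM ->
    forall m', m' \in msupp (gl_act g 'X_[m]) -> E (m' + u)%MM.
  elim: d => [|d IHd] m u.
    move/eqP; rewrite mdeg_eq0 => /eqP->.
    by rewrite mpolyX0 /gl_act comp_mpoly1 => Eu m'; rewrite msupp1 inE => /eqP->.
  move=> dm; have [l ml] : exists l, (0 < m l)%N.
    apply: NNPP => nl; move: dm; rewrite mdegE big1 // => l _.
    by apply/eqP; rewrite -leqn0 leqNgt; apply/negP => ml; apply: nl; exists l.
  have mK : ((m - U_(l)) + U_(l) = m)%MM by rewrite submK // lep1mP -lt0n.
  have dml : mdeg (m - U_(l)) = d.
    by apply: succn_inj; rewrite -dm -[in RHS]mK mdegD mdeg1 addn1.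
  rewrite -mK -addmA => /(IHd _ _ dml) IHm m'.
  rewrite mpolyXD gl_actM => /msuppM_le/allpairsP[[a b] /= [am bl ->]].
  have [k gk ->] : exists2 k, g k l != 0 & b = U_(k)%MM.
    apply: NNPP => nk; move: bl; rewrite gl_actXU mcoeff_msupp raddf_sum big1 ?eqxx //= => k _.
    rewrite mcoeffZ mcoeffX; have [->|gk] := eqVneq (g k l) 0; first by rewrite mul0r.
    by case: eqP => [kb|]; rewrite ?mulr0 //; case: nk; exists k.
  have addR v : (a + (v + u) = (a + u) + v)%MM by rewrite -addmA [(u + v)%MM]addmC.
  have := IHm _ am; rewrite -addmA !addR.
  have [<-//|kl] := eqVneq k l; apply: Ess.
  by rewrite ltn_neqAle kl gle.
move=> Ef; rewrite [f]mpolyE gl_act_sum big_seq; apply: (ideal_sum _ hE) => m /Ef Em.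
rewrite gl_actZ; apply: (idealZ _ hE) => m' /(mono _ m 0%MM erefl).
by rewrite !addm0; apply.
Qed.

(** * From generic forms to the last variables *)

Section GenericForms.

Variables (n p : nat) (hp : (p <= n)%N) (K : fieldType) (E : pred 'X_{1..n}).
Hypothesis charK : [pchar K]%R =i pred0.
Hypothesis Eup : up_closed E.
Hypothesis Ess : strongly_stable E.

Let L : 'M[K]_(p, n) := last_forms hp K.

Let mulmxLT q (A : 'M[K]_(q, n)) s t : (A *m L^T) s t = A s (last_variable hp t).
Proof.
rewrite mxE (bigD1 (last_variable hp t)) //= !mxE eqxx mulr1 big1 ?addr0 // => k kt.
by rewrite !mxE (negPf kt) mulr0.
Qed.

(* Row operations bring A to the form (C | 1), and a unipotent substitution
   fixing the first variables, which preserves a strongly stable ideal, then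
   brings the last variables to the forms of (C | 1). *)
Lemma koszul_le_generic (A : 'M[K]_(p, n)) :
  A *m L^T \in unitmx -> koszul_le (monomial_ideal E) L A.
Proof.
move=> Bu; have hE := monomial_ideal_ideal K Eup.
have LL : L *m L^T = 1%:M.
  apply/matrixP => s t; rewrite mulmxLT !mxE (inj_eq (@last_variable_inj _ _ hp)).
  by rewrite eq_sym.
pose C := invmx (A *m L^T) *m A; pose X := C - L.
have XL : X *m L^T = 0 by rewrite mulmxBl LL /C -mulmxA mulVmx // subrr.
(* 1 + N sends y_s to the s-th form of [C]. As [X] does not involve the last variables, N squares to
   zero and 1 - N is the inverse. *)
pose N := X^T *m L.
have NN : N *m N = 0.
  rewrite /N mulmxA -[X^T *m L *m X^T]mulmxA.
  have -> : L *m X^T = 0 by rewrite -[L]trmxK -trmx_mul XL trmx0.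
  by rewrite mulmx0 mul0mx.
have Nle k l : N k l != 0 -> (k <= l)%N.
  apply: contraNT; rewrite -ltnNge => lt_lk; rewrite mxE big1 // => s _.
  rewrite [L s l]mxE; case: eqP => [ls|]; last by rewrite mulr0.
  have pk : (n - p <= k)%N.
    by apply: leq_trans (ltnW lt_lk); rewrite ls val_last_variable leq_addr.
  have lt_kp : (k - (n - p) < p)%N by rewrite ltn_subLR // subnK // ltn_ord.
  have -> : k = last_variable hp (Ordinal lt_kp).
    by apply: val_inj; rewrite /= subnKC.
  by rewrite mulr1 mxE -mulmxLT XL mxE.
have J_gl (e : K) f : monomial_ideal E f -> monomial_ideal E (gl_act (1%:M + e *: N) f).
  apply: monomial_ideal_triangular => // k l; rewrite 2!mxE [X in _ + X]mxE.
  have [->//|kl] := eqVneq k l; rewrite add0r mulf_eq0 negb_or => /andP[_]; exact: Nle.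
have LC : L *m (1%:M + 1 *: N)^T = C.
  rewrite scale1r linearD /= trmx1 mulmxDr mulmx1 trmx_mul trmxK mulmxA LL mul1mx.
  by rewrite addrC subrK.
have le_LC : koszul_le (monomial_ideal E) L C.
  rewrite -LC; apply: (@koszul_le_gl_act _ _ _ _ _ _ (1%:M + (-1) *: N)).
  - by rewrite scale1r scaleN1r mulmxBr mulmx1 mulmxDl mul1mx NN addr0 addrK.
  - by rewrite scale1r scaleN1r mulmxDr mulmx1 mulmxBl mul1mx NN subr0 subrK.
  - exact: J_gl.
  - exact: J_gl.
apply: koszul_le_trans le_LC _.
have {1}<- : A *m L^T *m C = A by rewrite /C mulmxA mulmxV // mul1mx.
exact: unitmx_row_operation.
Qed.

(** The open set is given by the minor of A on its last p columns, which equals 1 at the last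
    variables. *)
Lemma koszul_betti_last i j d :
    has_quotient_dim (koszul_cycle (monomial_ideal E) L i j)
      (koszul_boundary (monomial_ideal E) L i j) d ->
  koszul_betti i j p (monomial_ideal (K := K) E) = d.
Proof.
move=> hd; have hE := monomial_ideal_ideal K Eup.
apply: (generic_valueE charK _ (polynomial_function_cst _ _ 1)).
  by move=> A; split=> // _; apply: oner_neq0.
apply/is_generic_valueE; exists (fun A => \det (A *m L^T)), L; split=> //.
- apply: polynomial_function_det => s t.
  apply: polynomial_function_ext (polynomial_function_entry K s (last_variable hp t)) => A.
  by rewrite mulmxLT.
- rewrite (_ : L *m L^T = 1%:M) ?det1 ?oner_neq0 //.
  by apply/matrixP => s t; rewrite mulmxLT !mxE (inj_eq (@last_variable_inj _ _ hp)) eq_sym.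
move=> A _ dA; apply: koszul_homology_dimE => //; apply: koszul_le_generic hd.
by rewrite unitmxE unitfE.
Qed.

End GenericForms.

(** * Counting critical cells *)

Section MonomialCounts.

Variable n : nat.
Implicit Types (P Q : pred 'X_{1..n}) (m : 'X_{1..n}).

Definition monomial_count d P : nat :=
  #|[pred m : 'X_{1..n < d.+1} | (mdeg (val m) == d) && P (val m)]|.

Lemma eq_monomial_count d P Q :
  (forall m, P m = Q m) -> monomial_count d P = monomial_count d Q.
Proof. by move=> PQ; apply: eq_card => m; rewrite !inE PQ. Qed.

Lemma monomial_count_split d P Q :
  monomial_count d P =
    (monomial_count d (fun m => P m && Q m) + monomial_count d (fun m => P m && ~~ Q m))%N.
Proof.
rewrite /monomial_count -(cardID [pred m : 'X_{1..n < d.+1} | Q (val m)]).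
congr (_ + _)%N; apply: eq_card => m; rewrite !inE; first by rewrite andbA.
by rewrite andbC andbA.
Qed.

Lemma monomial_count_shift d k P :
  monomial_count d.+1 (fun m => P m && (0 < m k)%N) =
    monomial_count d (fun m => P (m + U_(k))%MM).
Proof.
have lt_mk (m : 'X_{1..n < d.+1}) : (mdeg (val m + U_(k))%MM < d.+2)%N.
  by rewrite mdegD mdeg1 addn1 ltnS bmdeg.
pose f (m : 'X_{1..n < d.+1}) := BMultinom (lt_mk m).
have f_inj : injective f.
  by move=> m m' /(congr1 val) /= /addIm/val_inj.
rewrite /monomial_count -[RHS](card_imset _ f_inj); apply: eq_card => u; rewrite !inE.
apply/idP/imsetP => [/and3P[/eqP du Pu uk]|[m]]; last first.
  rewrite inE => /andP[/eqP dm Pm] ->.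
  by rewrite /= Pm mdegD mdeg1 dm addn1 eqxx mnmDE mnm1E eqxx addn1.
have uK : ((val u - U_(k)) + U_(k) = val u)%MM by rewrite submK // lep1mP -lt0n.
have du' : mdeg (val u - U_(k))%MM = d.
  by have := congr1 mdeg uK; rewrite mdegD mdeg1 du addn1 => -[].
have lt_du : (mdeg (val u - U_(k))%MM < d.+1)%N by rewrite du'.
exists (BMultinom lt_du); first by rewrite inE /= du' eqxx uK.
by apply: val_inj; rewrite /= uK.
Qed.

End MonomialCounts.

(** In the sum of c_t (h_{t+1} + l_t - l_{t+1}), each l_t with 0 < t < p gets the coefficient c_t -
    c_{t-1} >= 0; only l_p gets a negative one, and there both sides agree. The hypotheses are
    additive to avoid truncated subtraction. *)
Lemma abel_le (p : nat) (c a a' h h' l l' : nat -> nat) :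
    (forall t, c t <= c t.+1)%N ->
    (forall t, t < p -> a t + l t.+1 = h t.+1 + l t)%N ->
    (forall t, t < p -> a' t + l' t.+1 = h' t.+1 + l' t)%N ->
    (forall t, h t <= h' t)%N -> (forall t, l t <= l' t)%N -> l p = l' p ->
  (\sum_(t < p) c t * a t <= \sum_(t < p) c t * a' t)%N.
Proof.
move=> cS aE a'E hh' ll' lp.
(* Adding c_q l_q compensates the last negative term, so partial sums can be compared by
   induction. *)
suff h1 q : (q <= p)%N -> (\sum_(t < q) c t * a t + c q * l q <=
    \sum_(t < q) c t * a' t + c q * l' q)%N.
  by have := h1 p (leqnn p); rewrite lp leq_add2r.
elim: q => [_|q IHq lt_qp]; first by rewrite !big_ord0 leq_add2l leq_mul2l ll' orbT.
have {IHq} := IHq (ltnW lt_qp); rewrite !big_ord_recr /=.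
move: (\sum_(t < q) _)%N (\sum_(t < q) _)%N => A A' IH.
have [e ->] : exists e, c q.+1 = (c q + e)%N by exists (c q.+1 - c q)%N; rewrite subnKC.
have e1 : (e * l q.+1 <= e * l' q.+1)%N by rewrite leq_mul2l ll' orbT.
have e2 : (c q * h q.+1 <= c q * h' q.+1)%N by rewrite leq_mul2l hh' orbT.
have e3 := congr1 (muln (c q)) (aE q lt_qp).
have e4 := congr1 (muln (c q)) (a'E q lt_qp).
rewrite !mulnDr in e3 e4; rewrite !mulnDl; lia.
Qed.

Section CriticalCounts.

Variables (n p : nat) (hp : (p <= n)%N).
Implicit Types (E : pred 'X_{1..n}) (m : 'X_{1..n}) (S : {set 'I_p}) (t : 'I_p).
Local Notation nu := (last_variable hp).

(** The Hilbert function in degree d of the quotient of R/J by the y_t with t >= k; k = p gives R/J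
    itself. *)
Definition hilbert E d k : nat :=
  monomial_count d (fun m => first_variables (n - p + k) m && ~~ E m).

(** For k <= p, the binomial coefficient of k over i. *)
Definition initial_subsets i k : nat :=
  #|[set S : {set 'I_p} | (#|S| == i) && [forall s in S, (s < k)%N]]|.

Definition top t S : bool := (t \in S) && [forall s in S, (s <= t)%N].

(** The dimension of the kernel of multiplication by y_t on the degree d part of R/J modulo the
    later y's. *)
Definition socle_count E d t : nat :=
  monomial_count d (fun m => [&& first_variables (n - p + t.+1) m, ~~ E m & E (m + U_(nu t))%MM]).

Lemma first_variables_last k m :
  first_variables (n - p + k) m = [forall t : 'I_p, (k <= t)%N ==> (m (nu t) == 0%N)].
Proof.
apply/first_variablesP/forall_inP => [h t kt|h l kl].
  by rewrite h // val_last_variable leq_add2l.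
have lt_lp : (l - (n - p) < p)%N.
  by rewrite ltn_subLR ?subnK ?ltn_ord // (leq_trans _ kl) // leq_addr.
have -> : l = nu (Ordinal lt_lp).
  by apply: val_inj; rewrite /= subnKC // (leq_trans _ kl) // leq_addr.
by apply/eqP; apply: h; rewrite /= leq_subRL // (leq_trans _ kl) // leq_addr.
Qed.

Lemma top_exists S s0 : s0 \in S -> exists t, top t S.
Proof.
move=> s0S; case: (@arg_maxnP _ s0 (fun s => s \in S) val s0S) => t tS tmax.
by exists t; rewrite /top tS; apply/forall_inP => s /tmax.
Qed.

Lemma top_unique S t t' : top t S -> top t' S -> t = t'.
Proof.
move=> /andP[tS /forall_inP tm] /andP[t'S /forall_inP t'm].
by apply/val_inj/eqP; rewrite /= eqn_leq t'm ?tm.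
Qed.

(** Being movable depends only on max S, and by strong stability m y_t in E implies m y_s in E for s
    < t: so [S] matters only through its maximum. *)
Lemma critical_top E m S t : strongly_stable E -> top t S ->
  critical hp E m S =
    [&& first_variables (n - p + t.+1) m, ~~ E m & E (m + U_(nu t))%MM].
Proof.
move=> Ess /andP[tS /forall_inP tmax]; rewrite /critical; congr [&& _, _ & _].
  rewrite first_variables_last; apply/negP/forall_inP => [nm s ts|h /movableP[s [ms sS]]].
    rewrite -leqn0 leqNgt; apply/negP => ms; apply: nm; apply/movableP; exists s; split=> // r.
    by move/tmax => rt; apply: leq_ltn_trans rt ts.
  by move: ms; rewrite (eqP (h s (sS t tS))).
apply/forall_inP/idP => [|Et s]; first exact.
move/tmax; rewrite leq_eqVlt => /orP[/eqP/val_inj->//|st].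
by apply: Ess Et; rewrite !val_last_variable ltn_add2l.
Qed.

Lemma critical_set0 E m :
  critical hp E m set0 = first_variables (n - p + 0) m && ~~ E m.
Proof.
rewrite /critical; have -> : [forall s in (set0 : {set 'I_p}), E (m + U_(nu s))%MM].
  by apply/forall_inP => s; rewrite inE.
rewrite andbT first_variables_last; congr (_ && _).
apply/negP/forall_inP => [nm s _|h /movableP[s [ms _]]].
  rewrite -leqn0 leqNgt; apply/negP => ms; apply: nm; apply/movableP; exists s; split=> // r.
  by rewrite inE.
by move: ms; rewrite (eqP (h s isT)).
Qed.

Lemma critical_cellsE E d i : #|critical_cells hp E (d := d) i| =
  (\sum_(S : {set 'I_p} | #|S| == i) monomial_count d (fun m => critical hp E m S))%N.
Proof.
transitivity (\sum_(m : 'X_{1..n < d.+1})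
    \sum_(S : {set 'I_p} | [&& mdeg (val m) == d, #|S| == i & critical hp E (val m) S]) 1)%N.
  by rewrite pair_big_dep /= -sum1_card; apply: eq_bigl => -[].
rewrite (exchange_big_dep xpredT) //= [RHS]big_mkcond; apply: eq_bigr => S _.
case: ifP => iS; last by rewrite big1 // => m /and3P[_ /eqP iS'] _; case/eqP: (negbT iS).
rewrite /monomial_count -[RHS]sum1_card; apply: eq_bigl => m; rewrite inE.
by congr (_ && _); rewrite [X in X && _]iS.
Qed.

Lemma card_top i t :
  #|[set S : {set 'I_p} | (#|S| == i.+1) && top t S]| = initial_subsets i t.
Proof.
have tI : {in [set S : {set 'I_p} | (#|S| == i) && [forall s in S, (s < t)%N]] &,
    injective (fun S => t |: S)}.
  have tK S : S \in [set S : {set 'I_p} | (#|S| == i) && [forall s in S, (s < t)%N]] ->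
      (t |: S) :\ t = S.
    rewrite inE => /andP[_ /forall_inP tS]; rewrite setU1K //.
    by apply/negP => /tS; rewrite ltnn.
  by move=> S S' /tK {2}<- /tK {2}<- ->.
rewrite /initial_subsets -(card_in_imset tI); apply: eq_card => S; rewrite inE.
apply/idP/imsetP => [/and3P[/eqP iS tS /forall_inP tmax]|[S']]; last first.
  rewrite inE => /andP[/eqP iS' /forall_inP tS'] ->.
  have ntS' : t \notin S' by apply/negP => /tS'; rewrite ltnn.
  rewrite cardsU1 ntS' iS' add1n eqxx /top !inE eqxx /=; apply/forall_inP => s.
  by rewrite !inE => /predU1P[->//|/tS'/ltnW].
exists (S :\ t); last by rewrite setD1K.
rewrite inE; apply/andP; split.
  by have := cardsD1 t S; rewrite tS iS => -[->].
by apply/forall_inP => s; rewrite !inE => /andP[st /tmax]; rewrite ltn_neqAle st.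
Qed.

Lemma critical_cells0 E d : #|critical_cells hp E (d := d) 0| = hilbert E d 0.
Proof.
rewrite critical_cellsE (big_pred1 set0) => [|S]; last by rewrite cards_eq0.
by apply: eq_monomial_count => m; rewrite critical_set0.
Qed.

Lemma critical_cellsS E d i : strongly_stable E ->
  #|critical_cells hp E (d := d) i.+1| =
    (\sum_(t < p) initial_subsets i t * socle_count E d t)%N.
Proof.
move=> Ess; rewrite critical_cellsE.
transitivity (\sum_(S : {set 'I_p} | #|S| == i.+1) \sum_(t | top t S) socle_count E d t)%N.
  apply: eq_bigr => S /eqP iS.
  have [s sS] : exists s, s \in S by apply/set0Pn; rewrite -card_gt0 iS.
  have [t tS] := top_exists sS.
  rewrite (big_pred1 t) => [|t' /=]; last first.
    by apply/idP/eqP => [t'S|->//]; apply: top_unique t'S tS.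
  by apply: eq_monomial_count => m; rewrite (critical_top _ Ess tS).
rewrite (exchange_big_dep xpredT) //=; apply: eq_bigr => t _.
by rewrite sum_nat_const -card_top; congr (_ * _)%N; apply: eq_card => S; rewrite !inE.
Qed.

(** Rank and nullity for multiplication by y_t from degree d to d + 1 modulo the later y's: the
    kernel is counted by [socle_count], the image by [Q], and the cokernel is the quotient by y_t as
    well. *)
Lemma socle_countE E d t : up_closed E ->
  (socle_count E d t + hilbert E d.+1 t.+1 = hilbert E d t.+1 + hilbert E d.+1 t)%N.
Proof.
move=> Eup.
pose Q m := first_variables (n - p + t.+1) m && ~~ E (m + U_(nu t))%MM.
have hd : hilbert E d t.+1 = (socle_count E d t + monomial_count d Q)%N.
  rewrite /hilbert (monomial_count_split _ _ (fun m => E (m + U_(nu t))%MM)).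
  congr (_ + _)%N; apply: eq_monomial_count => m; rewrite -andbA //.
  congr (_ && _); apply/andP/idP => [[]//|nE]; split=> //.
  by apply: contra nE => Em; rewrite addmC; apply: Eup.
have hd1 : hilbert E d.+1 t.+1 = (monomial_count d Q + hilbert E d.+1 t)%N.
  rewrite /hilbert (monomial_count_split _ _ (fun m => (0 < m (nu t))%N)).
  congr (_ + _)%N.
    rewrite monomial_count_shift; apply: eq_monomial_count => m; congr (_ && _).
    rewrite !first_variables_last; apply: eq_forallb => s; case: ltnP => //= ts.
    rewrite mnmDE mnm1E (inj_eq (@last_variable_inj _ _ hp)).
    by rewrite (negbTE _ : (t == s) = false) ?addn0 // -val_eqE neq_ltn ts.
  apply: eq_monomial_count => m; rewrite -andbA [~~ E m && _]andbC andbA; congr (_ && _).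
  rewrite !first_variables_last; apply/andP/forall_inP => [[/forall_inP h mt] s|h].
    rewrite leq_eqVlt => /orP[/eqP/val_inj<-|]; last exact: h.
    by rewrite -leqn0 leqNgt.
  split; first by apply/forall_inP => s /ltnW; apply: h.
  by rewrite -leqNgt leqn0 h.
by rewrite hd hd1; lia.
Qed.

Theorem critical_cells_le E E' d i :
    up_closed E -> up_closed E' -> strongly_stable E -> strongly_stable E' ->
    (forall d k, hilbert E d k <= hilbert E' d k)%N ->
    (forall d, hilbert E d p = hilbert E' d p) ->
  (#|critical_cells hp E (d := d) i| <= #|critical_cells hp E' (d := d) i|)%N.
Proof.
move=> Eup Eup' Ess Ess' hh hhp; case: i => [|i]; first by rewrite !critical_cells0.
(* [abel_le] needs sequences indexed by all naturals; for t < p the subtraction is exact. *)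
pose a F (t : nat) := (hilbert F d t.+1 + hilbert F d.+1 t - hilbert F d.+1 t.+1)%N.
have aE F : up_closed F -> forall t : nat, (t < p)%N ->
    (a F t + hilbert F d.+1 t.+1 = hilbert F d t.+1 + hilbert F d.+1 t)%N /\
    forall t' : 'I_p, t' = t :> nat -> socle_count F d t' = a F t.
  move=> Fup t tp; have := socle_countE d (Ordinal tp) Fup; rewrite /= /a => e.
  rewrite -e addnK; split=> // t' t't; congr (socle_count _ _ _); exact: val_inj.
rewrite !critical_cellsS //.
have sumE F : up_closed F -> (\sum_(t < p) initial_subsets i t * socle_count F d t =
    \sum_(t < p) initial_subsets i t * a F t)%N.
  move=> Fup; apply: eq_bigr => t _; congr (_ * _)%N.
  by have [_ ->] := aE F Fup t (ltn_ord t).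
rewrite !sumE //.
have := @abel_le p (initial_subsets i) (a E) (a E') (hilbert E d) (hilbert E' d)
  (hilbert E d.+1) (hilbert E' d.+1).
apply=> // [t|t /(aE E Eup)[]|t /(aE E' Eup')[]] //.
apply: subset_leq_card; apply/subsetP => S; rewrite !inE => /andP[-> /forall_inP h] /=.
by apply/forall_inP => s /h; apply: ltnW.
Qed.

End CriticalCounts.

(** Monomials inside and outside E are complementary, so more initial monomials mean a smaller
    Hilbert function. *)
Lemma hilbert_degree_part n p (E : pred 'X_{1..n}) d k :
  (#|degree_part d (first_variables (n - p + k)) E| + hilbert p E d k =
   monomial_count d (@first_variables n (n - p + k)))%N.
Proof.
by rewrite (monomial_count_split _ _ E).
Qed.

Local Close Scope ring_scope.

Theorem theorem5p1 (n : nat) (K : fieldType) (hK : [pchar K]%R =i pred0)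
    (I : {mpoly K[n]} -> Prop) (hI : is_ideal I) (hIh : is_homogeneous I)
    (tau : rel 'X_{1..n}) (htau : is_term_order tau)
    (hvar : decreasing_variables tau)
    (i : nat) (j : int) (p : nat) (hp : p <= n) :
  koszul_betti i j p (Gin (@degrevlex n) I) <= koszul_betti i j p (Gin tau I).
Proof.
have [E [E' [-> -> [Eup E'up] [Ess E'ss] cmp]]] := Gin_comparison hK hI hIh htau hvar.
(* The coefficients of i-chains have degree j - i; when this is negative there are no nonzero chains
   and both numbers are 0. *)
case jid: (j - i%:Z)%R => [d|d]; last first.
  have zero F (Fup : up_closed F) (Fss : strongly_stable F) :=
    koszul_betti_last hK Fup Fss
      (koszul_homology_negative (last_forms hp K) (monomial_ideal_ideal K Fup) jid).
  by rewrite !zero.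
have betti F (Fup : up_closed F) (Fss : strongly_stable F) :=
  koszul_betti_last hK Fup Fss (koszul_homology_last hp K Fup Fss jid).
rewrite !betti //.
have le_h d' k : (hilbert p E d' k <= hilbert p E' d' k)%N.
  have [_ /(_ (n - p + k)%N)] := cmp d'.
  have := hilbert_degree_part p E d' k; rewrite -(hilbert_degree_part p E' d' k).
  lia.
apply: critical_cells_le => // d'.
(* For k = p no variable is killed, and the equality of Hilbert functions of the two quotients of R
   applies. *)
have allX F : #|degree_part d' (@first_variables n (n - p + p)) F| = #|degree_part d' predT F|.
  apply: eq_card => m; rewrite !inE; congr (_ && _); congr (_ && _).
  by apply/first_variablesP => l; rewrite subnK // leqNgt ltn_ord.
have [eqT _] := cmp d'.
have := hilbert_degree_part p E d' p; rewrite -(hilbert_degree_part p E' d' p) !allX eqT.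
by move/addnI.
Qed.
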